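(* Let $\gamma=((\gamma_1,\delta_1),\dots,(\gamma_{n-2},\delta_{n-2}))$ be dense. (1) Let $I$ be an ideal of $C_\gamma$ and let $Q$ be a prime ideal of $A_\gamma$ that is minimal over $IA_\gamma$. Then $Q$ is a Poisson prime ideal of $A_\gamma$. (2) If $Q$ is a nonzero proper Poisson prime ideal of $A_\gamma$, then $\mathrm{ht}(Q)=\mathrm{ht}(Q\cap C_\gamma)$. (3) If $Q$ is a nonzero proper Poisson prime ideal of $A_\gamma$, then $Q$ is a minimal prime ideal over $(Q\cap C_\gamma)A_\gamma$.
   Context: Let $n\ge 3$, $A=\mathbb{C}[x_1,\dots,x_n]$. Fix $s_1,t_1,\dots,s_{n-2},t_{n-2}\in A$ with each $t_i\ne 0$ and $s_i,t_i$ coprime, such that $s_1/t_1,\dots,s_{n-2}/t_{n-2}$ are algebraically independent over $\mathbb{C}$. $A$ carries the Poisson bracket $\{f,g\}=(t_1\cdots t_{n-2})^2\,\mathrm{Jac}(f,g,s_1/t_1,\dots,s_{n-2}/t_{n-2})$ ($\mathrm{Jac}$ = Jacobian determinant with respect to $x_1,\dots,x_n$), and every localization of $A$ inherits a Poisson bracket via the quotient rule. A sequence $\gamma=((\gamma_1,\delta_1),\dots,(\gamma_{n-2},\delta_{n-2}))\in(\{0,1\}\times\{0,1\})^{n-2}$ is dense if $(\gamma_i,\delta_i)\neq(0,0)$ for all $i$. For such $\gamma$: $S_\gamma\subseteq\{s_1,\dots,s_{n-2},t_1,\dots,t_{n-2}\}$ with $s_i\in S_\gamma\iff\gamma_i=1$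 and $t_i\in S_\gamma\iff\delta_i=1$; $M_\gamma$ is the multiplicatively closed subset of $A$ generated by $S_\gamma$; $A_\gamma=M_\gamma^{-1}A$; $v_i=s_i/t_i$ if $\delta_i=1$ and $v_i=t_i/s_i$ otherwise (so $v_i\in A_\gamma$); and $C_\gamma$ is the subalgebra of $A_\gamma$ generated by $v_1,\dots,v_{n-2}$. A Poisson prime ideal of $A_\gamma$ is a prime ideal $Q$ with $\{Q,A_\gamma\}\subseteq Q$; it is proper if the induced bracket on $A_\gamma/Q$ is nonzero. $\mathrm{ht}$ denotes height. *)

(* Defs.v *)
From HB Require Import structures.
From mathcomp Require Import all_boot all_algebra.
From mathcomp Require Import fraction.
From mathcomp Require Import reals Rstruct.
From mathcomp Require Import complex.
From mathcomp Require Import mpoly.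

Set Implicit Arguments.
Unset Strict Implicit.
Unset Printing Implicit Defensive.

Import GRing.Theory.
Local Open Scope ring_scope.

Notation "x %:F" := (@FracField.tofrac _ x) : ring_scope.

Definition CC : numClosedFieldType := (Rdefinitions.R)[i].

(* A = C[x_1, ..., x_n] and its fraction field Frac(A); every localization
   M^{-1}A (0 \notin M) is realised as a subring of Frac(A). *)
Definition Apoly (n : nat) : idomainType := {mpoly CC[n]}.
Definition Frac (n : nat) : fieldType := {fraction (Apoly n)}.

Section SubringAlgebra.
Variable K : fieldType.

Definition subsetP (X Y : K -> Prop) : Prop := forall x, X x -> Y x.

Definition is_ideal (R I : K -> Prop) : Prop :=
  subsetP I R /\ I 0 /\
  (forall x y, I x -> I y -> I (x + y)) /\
  (forall r x, R r -> I x -> I (r * x)).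

Definition is_prime (R P : K -> Prop) : Prop :=
  is_ideal R P /\ ~ P 1 /\
  (forall x y, R x -> R y -> P (x * y) -> P x \/ P y).

Definition ext_ideal (R I : K -> Prop) : K -> Prop :=
  fun x => forall J, is_ideal R J -> subsetP I J -> J x.

Definition minimal_prime_over (R J Q : K -> Prop) : Prop :=
  is_prime R Q /\ subsetP J Q /\
  (forall P, is_prime R P -> subsetP J P -> subsetP P Q -> subsetP Q P).

Definition ht_ge (R Q : K -> Prop) (k : nat) : Prop :=
  exists P : nat -> K -> Prop,
    (forall j, (j <= k)%N -> is_prime R (P j)) /\
    (forall x, P k x <-> Q x) /\
    (forall j, (j < k)%N ->
       subsetP (P j) (P j.+1) /\ exists x, P j.+1 x /\ ~ P j x).

(* ht(Q1) in R1 equals ht(Q2) in R2 (as elements of N \cup {oo}) *)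
Definition same_height (R1 Q1 R2 Q2 : K -> Prop) : Prop :=
  forall k, ht_ge R1 Q1 k <-> ht_ge R2 Q2 k.

End SubringAlgebra.

Section Bracket.
Variable n : nat.
Local Notation A := (Apoly n).
Local Notation F := (Frac n).

Definition fnum (x : F) : A := (repr x).1.
Definition fden (x : F) : A := (repr x).2.

Definition fpartial (i : 'I_n) (x : F) : F :=
  (((fnum x)^`M(i))%:F * (fden x)%:F - (fnum x)%:F * ((fden x)^`M(i))%:F)
    / ((fden x)%:F ^+ 2).

Definition jacobian (G : 'I_n -> F) : F :=
  \det (\matrix_(k < n, i < n) fpartial i (G k)).

Variables (s t : 'I_(n - 2) -> A).

Definition sratio (j : 'I_(n - 2)) : F := (s j)%:F / (t j)%:F.

Definition jac_args (f g : F) (k : 'I_n) : F :=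
  if val k == 0%N then f
  else if val k == 1%N then g
  else oapp (fun j : 'I_(n - 2) => sratio j) 0 (insub (val k - 2)%N).

Definition pbracket (f g : F) : F :=
  (\prod_(j < n - 2) (t j)%:F) ^+ 2 * jacobian (jac_args f g).

Variables (gam dlt : 'I_(n - 2) -> bool).

Definition dense : Prop := forall j, gam j || dlt j.

Definition Mgamma (m : A) : Prop :=
  exists e f : 'I_(n - 2) -> nat,
    m = \prod_(j < n - 2)
          ((if gam j then s j ^+ e j else 1) * (if dlt j then t j ^+ f j else 1)).

Definition Agamma (x : F) : Prop :=
  exists a m, Mgamma m /\ x = a%:F / m%:F.

Definition vgamma (j : 'I_(n - 2)) : F :=
  if dlt j then (s j)%:F / (t j)%:F else (t j)%:F / (s j)%:F.

Definition cst (c : CC) : F := (c%:MP : A)%:F.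

Definition Cgamma (x : F) : Prop :=
  exists p : {mpoly CC[n - 2]}, x = mmap cst vgamma p.

Definition poisson_prime (Q : F -> Prop) : Prop :=
  is_prime Agamma Q /\ (forall a b, Q a -> Agamma b -> Q (pbracket a b)).

(* the induced bracket on A_gamma / Q is nonzero *)
Definition proper_poisson (Q : F -> Prop) : Prop :=
  exists a b, Agamma a /\ Agamma b /\ ~ Q (pbracket a b).

Definition nonzero_ideal (Q : F -> Prop) : Prop := exists x, Q x /\ x <> 0.

End Bracket.

Definition coprime_poly (n : nat) (a b : Apoly n) : Prop :=
  forall d : Apoly n, (exists q, a = q * d) -> (exists q, b = q * d) ->
    exists c : CC, c != 0 /\ d = c%:MP.

Definition alg_indep (n : nat) (s t : 'I_(n - 2) -> Apoly n) : Prop :=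
  forall p : {mpoly CC[n - 2]}, mmap (@cst n) (sratio s t) p = 0 -> p = 0.

(* Main.v *)
(* A prime [P] of a polynomial ring in [N] variables over a field of characteristic
   zero is the kernel of a point [psi] with values in a field [K]. Adjoining the
   coordinates of [psi] one at a time produces a chain of [h] primes below [P] (one
   step for each coordinate that is algebraic over the previous ones) and [d = N - h]
   elements independent modulo [P]; an independent family gains an element when [P]
   shrinks, so [h] is the height of [P]. Since derivations extend in characteristic
   zero, [d] is also the dimension of the tangent space at [psi], the space of [u]
   with [sum_l u_l psi (d_l f) = 0] for all [f] in [P].

   Let [Q] be a prime of [A_gamma] with contraction [P] to [C_gamma]. The Jacobian
   matrix of [v] maps the tangent space of [Q] onto that of [P]. If
   [{x_i, x_j}] is not in [Q], its kernel has dimension at most 2, because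
   [{x_i, x_j}] is the determinant of the system formed by [dx_i], [dx_j] and the
   [dv_k]; if moreover [Q] is Poisson, the kernel contains the Hamiltonian vectors of
   [x_i] and [x_j], hence has dimension 2 and [Q] and [P] have the same height. A
   prime strictly between [P A_gamma] and [Q] would have a tangent space of larger
   dimension over the same [P], contradicting the upper bound.

   For the first part, the bracket with a fixed element is a derivation which
   preserves the ideal generated by [I], and the largest invariant ideal contained in
   a prime is prime in characteristic zero. *)

Require Import Defs.
From HB Require Import structures.
From mathcomp Require Import all_boot all_algebra.
From mathcomp Require Import perm fraction ring_quotient generic_quotient.
From mathcomp Require Import reals Rstruct.
From mathcomp Require Import complex.
From mathcomp Require Import mpoly.
From mathcomp Require Import boolp ring.
Import GRing.Theory.
Local Open Scope ring_scope.

Set Implicit Arguments.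
Unset Strict Implicit.

(** * Prime ideals as kernels of points with values in a field *)

Definition prime_pred (R : comNzRingType) (P : R -> Prop) : Prop :=
  [/\ P 0, forall x y, P x -> P y -> P (x + y),
      forall r x, P x -> P (r * x), ~ P 1 &
      forall x y, P (x * y) -> P x \/ P y].

(** The fraction field construction requires a unit predicate and an inverse on [Q]; both are
    supplied by classical choice, and [Q] then embeds in its field of fractions. *)
Lemma domain_embeds (Q : comNzRingType) :
  (forall x y : Q, x * y = 0 -> (x == 0) || (y == 0)) ->
  exists (K : fieldType) (f : {rmorphism Q -> K}), injective f.
Proof.
move=> Qdom.
pose U : {pred Q} := fun x => `[< exists y, y * x = 1 >].
pose inv (x : Q) := if pselect (exists y, y * x = 1) is left e then sval (cid e) else x.
have mulVx : {in U, left_inverse 1 inv *%R}.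
  move=> x /asboolP Ux; rewrite /inv; case: pselect => // e.
  by case: (cid e).
have unitPl x y : y * x = 1 -> U x by move=> yx; apply/asboolP; exists y.
have invr_out : {in [predC U], inv =1 id}.
  by move=> x /asboolPn nUx; rewrite /inv; case: pselect.
pose m1 := GRing.ComNzRing_hasMulInverse.Build Q mulVx unitPl invr_out.
pose Q1 : comUnitRingType := HB.pack Q m1.
pose m2 := GRing.ComUnitRing_isIntegral.Build Q1 Qdom.
pose D : idomainType := HB.pack Q Q1 m2.
pose f : Q -> {fraction D} := @FracField.tofrac D.
have fB : zmod_morphism f := rmorphB (@FracField.tofrac D).
have fM : monoid_morphism f := conj (rmorph1 (@FracField.tofrac D)) (rmorphM (@FracField.tofrac D)).
pose fm1 := GRing.isZmodMorphism.Build Q {fraction D} f fB.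
pose fm2 := GRing.isMonoidMorphism.Build Q {fraction D} f fM.
pose F : {rmorphism Q -> {fraction D}} := HB.pack f fm1 fm2.
by exists {fraction D}, F => x y /eqP; rewrite (@tofrac_eq D) => /eqP.
Qed.

Section PrimeKernel.
Local Open Scope quotient_scope.

(** [psi] is the quotient map modulo [P] followed by the embedding of the quotient domain in a
    field. *)
Lemma prime_kernel (R : comNzRingType) (P : R -> Prop) : prime_pred P ->
  exists (K : fieldType) (psi : {rmorphism R -> K}), forall x, psi x = 0 <-> P x.
Proof.
case=> P0 PD PM P1 Pp.
pose I : {pred R} := fun x => `[< P x >].
have IP x : reflect (P x) (x \in I) by exact: asboolP.
have Icl : idealr_closed I.
  split; [exact/IP | exact/IP | move=> a x y /IP Px /IP Py].
  by apply/IP/PD => //; apply: PM.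
have Ipr : prime_idealr_closed I.
  by move=> x y /IP /Pp[] /IP -> //; rewrite orbT.
pose I1 := isIdealr.Build R I Icl.
pose I2 := isPrimeIdealrClosed.Build R I Ipr.
pose pI : prime_idealr R := HB.pack I I1 I2.
have [K [f f_inj]] := domain_embeds (@Quotient.rquot_IdomainAxiom R pI).
exists K, (f \o \pi_{ideal_quot pI})%FUN => x /=.
have -> : f (\pi x) = 0 <-> \pi_{ideal_quot pI} x = \pi 0.
  rewrite rmorph0 -[in X in X <-> _](rmorph0 f).
  by split=> [/f_inj|->].
split=> [/eqP|Px]; last apply/eqP.
  by rewrite -Quotient.idealrBE subr0 => /IP.
by rewrite -Quotient.idealrBE subr0; apply/IP.
Qed.

End PrimeKernel.

Lemma kernel_prime (R : comNzRingType) (K : idomainType) (psi : {rmorphism R -> K})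
    (P : R -> Prop) : (forall x, psi x = 0 <-> P x) -> prime_pred P.
Proof.
move=> kerP; split=> [|x y /kerP x0 /kerP y0|r x /kerP x0|/kerP/eqP|x y /kerP/eqP].
- by apply/kerP; rewrite rmorph0.
- by apply/kerP; rewrite rmorphD x0 y0 addr0.
- by apply/kerP; rewrite rmorphM x0 mulr0.
- by rewrite rmorph1 oner_eq0.
- by rewrite rmorphM mulf_eq0 => /orP[]/eqP/kerP; [left | right].
Qed.

(** * Derivations and tangent vectors *)

(** The last clause makes [delta] factor through [psi]: it is a derivation of the subring [psi R]
    into [K], recorded on [R] so that no subring has to be formed. *)
Definition derivation_along (R : nzRingType) (K : fieldType) (psi delta : R -> K) : Prop :=
  [/\ forall x y, delta (x + y) = delta x + delta y,
      forall x y, delta (x * y) = psi x * delta y + delta x * psi y &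
      forall x, psi x = 0 -> delta x = 0].

Section ExtendDerivation.
Context {R : idomainType} {K : fieldType} (psi : {rmorphism R -> K}).
Hypothesis char0 : forall n, n.+1%:R != 0 :> K.

(** A [g] of least size serves as minimal polynomial of [b] over the image of [psi], with
    denominators cleared. A leading term killed by [psi] could be dropped. If the derivative
    vanished at [b], it would have zero image by minimality, and in characteristic zero the image of
    [g] would be constant. *)
Lemma minpoly_along (b : K) (g0 : {poly R}) :
  map_poly psi g0 != 0 -> (map_poly psi g0).[b] = 0 ->
  exists g : {poly R}, [/\ (map_poly psi g).[b] = 0, psi (lead_coef g) != 0,
    (map_poly psi g^`()).[b] != 0 &
    forall r : {poly R}, (size r < size g)%N -> (map_poly psi r).[b] = 0 ->
      map_poly psi r = 0].
Proof.
move=> g0n0 g0b.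
pose p m := `[< exists g : {poly R}, [/\ size g = m, map_poly psi g != 0 &
  (map_poly psi g).[b] = 0] >].
have ex_p : exists m, p m by exists (size g0); apply/asboolP; exists g0.
case: (ex_minnP ex_p) => m /asboolP[g [<- gn0 gb]] g_min.
have g_min' (r : {poly R}) : (size r < size g)%N -> (map_poly psi r).[b] = 0 -> map_poly psi r = 0.
  move=> rg rb; apply/eqP/negPn/negP => rn0.
  by move: rg; rewrite ltnNge g_min //; apply/asboolP; exists r.
have g_n0 : g != 0 by apply: contraNneq gn0 => ->; rewrite rmorph0.
have lead_g : psi (lead_coef g) != 0.
  apply/negP => /eqP lg0.
  pose r := g - (lead_coef g)%:P * 'X^((size g).-1).
  have psi_r : map_poly psi r = map_poly psi g.
    by rewrite rmorphB rmorphM /= map_polyC /= lg0 mul0r subr0.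
  have size_r : (size r < size g)%N.
    rewrite -[X in (_ < X)%N]prednK ?size_poly_gt0 // ltnS.
    apply/leq_sizeP => j; rewrite coefB coefCM coefXn leq_eqVlt.
    case/orP=> [/eqP<-|lt_j]; first by rewrite eqxx mulr1 subrr.
    by rewrite gtn_eqF // mulr0 subr0 nth_default // (leq_trans (leqSpred _)).
  by move: gn0; rewrite -psi_r (g_min' r) ?eqxx // psi_r.
exists g; split=> //; apply/negP => /eqP g'b.
have := g_min' _ (lt_size_deriv g_n0) g'b; rewrite -deriv_map => g'0.
have size1 : (size (map_poly psi g) <= 1)%N.
  apply/leq_sizeP => -[//|j _].
  have /eqP := congr1 (fun q : {poly K} => q`_j) g'0.
  by rewrite coef_deriv coef0 -mulr_natr mulf_eq0 (negPf (char0 j)) orbF => /eqP.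
move: gn0 gb; rewrite (size1_polyC size1) hornerC => gn0 gb.
by move: gn0; rewrite gb polyC0 eqxx.
Qed.

(** The extension is [dd], which applies [delta] to the coefficients, plus the formal derivative
    times [beta], the value at the variable. If [b] is transcendental over the image of [psi], any
    [beta] works; otherwise it is forced by the minimal polynomial, whose derivative does not vanish
    at [b]. *)
Lemma derivation_ext (delta : R -> K) (b : K) : derivation_along psi delta ->
  exists delta' : {poly R} -> K,
    derivation_along (horner_eval b \o map_poly psi)%FUN delta' /\
    forall c, delta' c%:P = delta c.
Proof.
case=> dD dM d_ker.
have d0 : delta 0 = 0 by apply: d_ker; rewrite rmorph0.
pose ev (q : {poly R}) := (map_poly psi q).[b].
pose dd (q : {poly R}) := \sum_(i < size q) delta q`_i * b ^+ i.
have ddE m (q : {poly R}) : (size q <= m)%N -> dd q = \sum_(i < m) delta q`_i * b ^+ i.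
  move=> le_qm; rewrite /dd (big_ord_widen _ (fun i => delta q`_i * b ^+ i) le_qm).
  rewrite big_mkcond; apply: eq_bigr => i _; case: ltnP => // le_qi.
  by rewrite nth_default // d0 mul0r.
have ddD x y : dd (x + y) = dd x + dd y.
  pose m := maxn (size x) (size y).
  rewrite !(ddE m) ?leq_maxl ?leq_maxr ?size_polyD // -big_split.
  by apply: eq_bigr => i _; rewrite coefD dD mulrDl.
have ddC c : dd c%:P = delta c.
  by rewrite (ddE 1%N) ?size_polyC_leq1 // big_ord1 coefC mulr1.
have evD x y : ev (x + y) = ev x + ev y by rewrite /ev rmorphD hornerD.
have evM x y : ev (x * y) = ev x * ev y by rewrite /ev rmorphM hornerM.
have evC c : ev c%:P = psi c by rewrite /ev map_polyC hornerC.
have evX : ev 'X = b by rewrite /ev map_polyX hornerX.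
have ddX x : dd (x * 'X) = dd x * b.
  rewrite (ddE (size x).+1) ?(leq_trans (size_polyMleq _ _)) ?size_polyX ?addn2 //.
  rewrite big_ord_recl coefMX d0 mul0r add0r /dd mulr_suml.
  by apply: eq_bigr => i _; rewrite coefMX exprSr mulrA.
have ddCM c x : dd (c%:P * x) = psi c * dd x + delta c * ev x.
  elim/poly_ind: x => [|x e IHx].
    by rewrite mulr0 /dd size_poly0 big_ord0 /ev rmorph0 horner0 !mulr0 addr0.
  rewrite mulrDr mulrA !ddD !ddX IHx -polyCM !ddC dM evD evM evX evC.
  by rewrite !mulrDr !mulrDl !mulrA addrACA.
have ddM x y : dd (x * y) = ev x * dd y + dd x * ev y.
  elim/poly_ind: x => [|x e IHx].
    by rewrite mul0r /dd size_poly0 big_ord0 /ev rmorph0 horner0 !mul0r addr0.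
  rewrite mulrDl -mulrA [_ * y]mulrC mulrA !ddD !ddX ddCM IHx evD evM evX evC ddC.
  rewrite !mulrDl addrACA; congr (_ + _ + (_ + _)); last exact: mulrAC.
  exact: mulrAC.
have dd_ker x : map_poly psi x = 0 -> dd x = 0.
  move=> x0; rewrite /dd big1 // => i _; rewrite d_ker ?mul0r //.
  by rewrite -coef_map x0 coef0.
suff [beta beta_ker] : exists beta, forall x, ev x = 0 -> dd x + ev x^`() * beta = 0.
  exists (fun x => dd x + ev x^`() * beta); split; [split=> // x y|move=> c] => /=.
  - by rewrite derivD ddD evD mulrDl addrACA.
  - rewrite /= /horner_eval -![(map_poly psi _).[b]]/(ev _) derivM evD !evM ddM; ring.
  - by rewrite derivC ddC /ev rmorph0 horner0 mul0r addr0.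
have [trans|] := pselect (forall x, ev x = 0 -> map_poly psi x = 0).
  by exists 0 => x /trans/dd_ker ->; rewrite mulr0 addr0.
move=> /existsNP[g0 /not_implyP[g0b /eqP g0n0]].
have [g [gb lg g'b g_min]] := minpoly_along g0n0 g0b.
exists (- dd g / ev g^`()) => x x0.
pose beta := - dd g / ev g^`().
pose D q := dd q + ev q^`() * beta.
have DM q1 q2 : D (q1 * q2) = ev q1 * D q2 + D q1 * ev q2.
  rewrite /D derivM evD !evM ddM; ring.
have Dg : D g = 0 by rewrite /D /beta mulrC divfK ?addrN.
have evg : ev g = 0 by [].
(* Pseudo-division: the multiplier [c] is a power of the leading coefficient, hence not killed by
   [psi], and the remainder has zero image by minimality of [g]. Applying [D] to the division
   identity leaves [psi c * D x = 0]. *)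
have xE := Pdiv.Idomain.divp_eq x g.
set c := lead_coef g ^+ _ in xE; set r := x %% g in xE.
have c_n0 : psi c != 0 by rewrite rmorphXn expf_neq0.
have r0 : map_poly psi r = 0.
  apply: g_min.
    rewrite ltn_modpN0 // -lead_coef_eq0.
    by apply: contraNneq lg => ->; rewrite rmorph0.
  have := congr1 ev xE; rewrite -mul_polyC evD !evM x0 evg !mulr0 add0r => /esym.
  exact.
apply/eqP; rewrite -(mulrI_eq0 _ (mulfI c_n0)); apply/eqP.
have := congr1 D xE; rewrite -mul_polyC.
have DD q1 q2 : D (q1 + q2) = D q1 + D q2 by rewrite /D derivD ddD evD; ring.
have Dr : D r = 0 by rewrite /D dd_ker // /ev -deriv_map r0 deriv0 horner0 mul0r addr0.
by rewrite DD !DM Dr Dg x0 evg evC !mulr0 !addr0.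
Qed.
End ExtendDerivation.

(** [R'] is an iterated polynomial ring over [R] with one variable for each element of [s];
    algebraic relations among these elements are absorbed in the kernel of [psi']. *)
Lemma derivation_adjoin (K : fieldType) (s : seq K) :
  (forall n, n.+1%:R != 0 :> K) ->
  forall (R : idomainType) (psi : {rmorphism R -> K}) (delta : R -> K),
  derivation_along psi delta ->
  exists (R' : idomainType) (j : {rmorphism R -> R'}) (psi' : {rmorphism R' -> K})
    (delta' : R' -> K),
    [/\ derivation_along psi' delta', forall c, psi' (j c) = psi c,
        forall c, delta' (j c) = delta c & forall x, x \in s -> exists z, psi' z = x].
Proof.
move=> char0; elim: s => [|b s IHs] R psi delta d_psi.
  by exists R, idfun, psi, delta.
have [delta1 [d1 d1C]] := derivation_ext char0 b d_psi.
have [R' [j [psi' [delta' [d' psi'j d'j surj]]]]] := IHs _ _ _ d1.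
exists R', (j \o polyC)%FUN, psi', delta'; split=> // [c|c|x].
- by rewrite /= psi'j /= map_polyC /horner_eval hornerC.
- by rewrite /= d'j.
- rewrite inE => /orP[/eqP->|/surj //]; exists (j 'X).
  by rewrite psi'j /= map_polyX /horner_eval hornerX.
Qed.

Section Tangent.
Variable k : idomainType.

Lemma mpoly_ringind N (P : {mpoly k[N]} -> Prop) :
  (forall c, P c%:MP) -> (forall i, P 'X_i) ->
  (forall p q, P p -> P q -> P (p + q)) ->
  (forall p q, P p -> P q -> P (p * q)) -> forall p, P p.
Proof.
move=> PC PX PD PM; elim/mpolyind => [|c m p _ _ Pp]; first by rewrite -mpolyC0.
apply: PD => //; rewrite -mul_mpolyC; apply: (PM) => //.
rewrite mpolyXE_id; apply: (big_ind P) => [|p1 q1|i _]; [by rewrite -mpolyC1 | exact: PM |].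
by elim: (m i) => [|n IHn]; rewrite ?expr0 -?mpolyC1 // exprS; exact: PM.
Qed.

Lemma rmorph_mpoly_eq N (S : nzRingType) (f g : {rmorphism {mpoly k[N]} -> S}) :
  (forall c, f c%:MP = g c%:MP) -> (forall i, f 'X_i = g 'X_i) -> f =1 g.
Proof.
move=> fgC fgX; elim/mpoly_ringind => // p q Ep Eq.
  by rewrite !rmorphD Ep Eq.
by rewrite !rmorphM Ep Eq.
Qed.

Lemma mderiv_var N (i l : 'I_N) : ('X_i : {mpoly k[N]})^`M(l) = (i == l)%:R.
Proof.
rewrite mderivX mnm1E; have [->|_] := eqVneq; last exact: scale0r.
rewrite scale1r (_ : _ - _ = 0)%MM ?mpolyX0 //.
by apply/mnmP => j; rewrite mnmBE subnn mnm0E.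
Qed.

Variable K : fieldType.
Hypothesis char0 : forall n, n.+1%:R != 0 :> K.

Definition tan_along N (psi : {mpoly k[N]} -> K) (u : 'rV[K]_N) (f : {mpoly k[N]}) : K :=
  \sum_l u 0 l * psi f^`M(l).

Definition tangent N (psi : {mpoly k[N]} -> K) (u : 'rV[K]_N) : Prop :=
  forall f, psi f = 0 -> tan_along psi u f = 0.

Section Point.
Context {N : nat} (psi : {rmorphism {mpoly k[N]} -> K}).

Lemma tan_alongD u f g :
  tan_along psi u (f + g) = tan_along psi u f + tan_along psi u g.
Proof.
by rewrite -big_split; apply: eq_bigr => l _; rewrite mderivD rmorphD mulrDr.
Qed.

Lemma tan_alongM u f g :
  tan_along psi u (f * g) = psi f * tan_along psi u g + tan_along psi u f * psi g.
Proof.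
rewrite mulr_sumr mulr_suml -big_split; apply: eq_bigr => l _ /=.
rewrite mderivM rmorphD !rmorphM; ring.
Qed.

Lemma tan_alongC u c : tan_along psi u c%:MP = 0.
Proof. by rewrite /tan_along big1 // => l _; rewrite mderivC rmorph0 mulr0. Qed.

Lemma tan_alongX u i : tan_along psi u 'X_i = u 0 i.
Proof.
rewrite /tan_along (bigD1 i) //= big1 ?addr0 => [|l li].
  by rewrite mderiv_var eqxx rmorph1 mulr1.
by rewrite mderiv_var eq_sym (negPf li) rmorph0 mulr0.
Qed.

Lemma derivation_tan_along (d : {mpoly k[N]} -> K) :
  (forall f g, d (f + g) = d f + d g) ->
  (forall f g, d (f * g) = psi f * d g + d f * psi g) ->
  (forall c, d c%:MP = 0) ->
  forall f, d f = tan_along psi (\row_l d 'X_l) f.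
Proof.
move=> dD dM dC; elim/mpoly_ringind => [c|i|p q Ep Eq|p q Ep Eq].
- by rewrite dC tan_alongC.
- by rewrite tan_alongX mxE.
- by rewrite dD tan_alongD Ep Eq.
- by rewrite dM tan_alongM Ep Eq.
Qed.

End Point.

(* The tangent vector [w] is a derivation of [k[chi]] into [K]; in characteristic
   zero it extends to a derivation of the algebra generated by [chi] and [psi]. *)
Lemma tangent_lift m N (psi : {rmorphism {mpoly k[N]} -> K})
    (chi : {rmorphism {mpoly k[m]} -> K}) (num den : 'I_m -> {mpoly k[N]}) :
  (forall c, chi c%:MP = psi c%:MP) ->
  (forall j, chi 'X_j * psi (den j) = psi (num j)) ->
  forall w, tangent chi w -> exists u, tangent psi u /\
    forall j, w 0 j * psi (den j) + chi 'X_j * tan_along psi u (den j)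
              = tan_along psi u (num j).
Proof.
move=> chiC chiX w tw.
have dw : derivation_along chi (tan_along chi w).
  by split=> [x y|x y|]; [exact: tan_alongD | exact: tan_alongM | exact: tw].
have [S [j [chi' [d [[dD dM dk] chi'j dj surj]]]]] :=
  derivation_adjoin [seq psi 'X_i | i : 'I_N] char0 dw.
have /choice[z zE] : forall i, exists z, chi' z = psi 'X_i.
  by move=> i; apply/surj/map_f; rewrite mem_enum.
(* Each variable goes to a preimage in [S] of its coordinate, so [chi' \o rho] is [psi] and
   [d \o rho] is a derivation along [psi], that is, the sought tangent vector. *)
pose rho : {rmorphism {mpoly k[N]} -> S} := mmap (j \o @mpolyC m k)%FUN z.
have rhoC c : rho c%:MP = j c%:MP by rewrite /rho /= mmapC.
have rhoX i : rho 'X_i = z i by rewrite /rho /= mmapX mmap1U.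
have rhoE : (chi' \o rho)%FUN =1 psi.
  apply: (@rmorph_mpoly_eq _ _ (chi' \o rho)%FUN psi) => [c|i] /=.
    by rewrite rhoC chi'j.
  by rewrite rhoX.
have drho f : d (rho f) = tan_along psi (\row_l d (z l)) f.
  rewrite -[LHS]/((d \o rho)%FUN f) (derivation_tan_along (psi := psi) (d := d \o rho)%FUN).
  - by congr (tan_along _ _ _); apply/rowP => l; rewrite !mxE /= rhoX.
  - by move=> a b /=; rewrite rmorphD dD.
  - by move=> a b /=; rewrite rmorphM dM -!rhoE.
  - by move=> c /=; rewrite rhoC dj tan_alongC.
exists (\row_l d (z l)); split=> [f f0|i].
  by rewrite -drho dk // -[chi' _]/((chi' \o rho)%FUN f) rhoE.
rewrite -!drho -(tan_alongX chi w) -dj -!rhoE /= -chi'j addrC -dM.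
apply/eqP; rewrite -subr_eq0; apply/eqP.
have dN x : d (- x) = - d x.
  have d0 : d 0 = 0 by apply: dk; rewrite rmorph0.
  by apply/eqP; rewrite -subr_eq0 opprK -dD addNr d0.
(* The relation between [num], [den] and the variable holds after [chi'], so [d] kills the
   corresponding element of [S]. *)
rewrite -dN -dD dk // rmorphB rmorphM chi'j.
by rewrite -![chi' (rho _)]/((chi' \o rho)%FUN _) !rhoE chiX subrr.
Qed.

End Tangent.

(** * Chains of primes in a polynomial ring *)

(** Height at least [m], with the chain built downwards from [P] to suit induction on [m]. *)
Fixpoint ht_chain (R : comNzRingType) (m : nat) (P : R -> Prop) : Prop :=
  prime_pred P /\
  if m is m'.+1 then
    exists P', [/\ ht_chain m' P', forall x, P' x -> P x & exists x, P x /\ ~ P' x]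
  else True.

Section Chains.
Variable R : comNzRingType.
Implicit Types P Q : R -> Prop.

Lemma ht_chain_prime m P : ht_chain m P -> prime_pred P.
Proof. by case: m => [|m] []. Qed.

Lemma ht_chainW m P : ht_chain m.+1 P -> ht_chain m P.
Proof.
elim: m P => [|m IHm] P [Pp [P' [P'm P'P sP]]]; first by split.
by split=> //; exists P'; split=> //; apply: IHm.
Qed.

Lemma ht_chain_leq m m' P : (m <= m')%N -> ht_chain m' P -> ht_chain m P.
Proof. by move=> /subnK <-; elim: (m' - m)%N => // j IHj /ht_chainW. Qed.

Lemma pred_ext P Q : (forall x, P x <-> Q x) -> P = Q.
Proof. by move=> PQ; apply/funext => x; apply/propext. Qed.

End Chains.

(** * Splitting off the last variable *)

Section LastVariable.
Variable k : fieldType.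
Variable N : nat.

Let wid (i : 'I_N) : 'I_N.+1 := widen_ord (leqnSn N) i.

Lemma muni_widen (i : 'I_N) : muni ('X_(wid i) : {mpoly k[N.+1]}) = ('X_i)%:P.
Proof.
rewrite muniE msuppX big_seq1 mcoeffX eqxx scale1r.
rewrite mnm1E -val_eqE /= ltn_eqF // expr0 alg_polyC; congr ('X_[_])%:P.
by apply/mnmP => j; rewrite mnmE !mnm1E -!val_eqE.
Qed.

Lemma muni_max : muni ('X_ord_max : {mpoly k[N.+1]}) = 'X.
Proof.
rewrite muniE msuppX big_seq1 mcoeffX eqxx scale1r mnm1E eqxx expr1.
rewrite (_ : [multinom _ | _ < _] = 0%MM) ?mpolyX0 ?scale1r //.
by apply/mnmP => j; rewrite mnmE mnm1E mnm0E -val_eqE /= gtn_eqF.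
Qed.

Lemma mwiden_var (i : 'I_N) : mwiden ('X_i : {mpoly k[N]}) = 'X_(wid i).
Proof. by rewrite /mwiden mmapX mmap1U. Qed.

Lemma ord_wid (i : 'I_N.+1) : i = ord_max \/ exists j, i = wid j.
Proof.
case: (unliftP ord_max i) => [j ->|->]; [right|by left].
by exists j; apply/val_inj; rewrite /= /bump leqNgt ltn_ord.
Qed.

Lemma muni_mwiden (p : {mpoly k[N]}) : muni (mwiden p) = p%:P.
Proof.
apply: (@rmorph_mpoly_eq k N _ (@muni N k \o @mwiden N k)%FUN polyC) => [c|i] /=.
  by rewrite mwidenC muniC.
by rewrite mwiden_var muni_widen.
Qed.

Definition of_uni (q : {poly {mpoly k[N]}}) : {mpoly k[N.+1]} :=
  (map_poly (@mwiden N k) q).['X_ord_max].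

Lemma of_uniK : cancel of_uni (@muni N k).
Proof.
rewrite /of_uni; elim/poly_ind => [|q c IHq]; first by rewrite rmorph0 horner0 rmorph0.
rewrite rmorphD rmorphM /= map_polyX map_polyC hornerMXaddC.
by rewrite rmorphD rmorphM /= IHq muni_max muni_mwiden.
Qed.

Lemma muni_inj (p : {mpoly k[N.+1]}) : muni p = 0 -> p = 0.
Proof.
suff pE : of_uni (muni p) = p.
  by move=> p0; rewrite -pE p0 /of_uni rmorph0 horner0.
pose f : {rmorphism {mpoly k[N.+1]} -> {mpoly k[N.+1]}} :=
  (horner_eval 'X_ord_max \o map_poly (@mwiden N k) \o @muni N k)%FUN.
apply: (@rmorph_mpoly_eq k _ _ f idfun) => [c|i] /=.
  by rewrite muniC map_polyC /horner_eval hornerC /= mwidenC.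
have [->|[j ->]] := ord_wid i.
  by rewrite muni_max map_polyX /horner_eval hornerX.
by rewrite muni_widen map_polyC /horner_eval hornerC /= mwiden_var.
Qed.

(** The extended ideal is the kernel of the coefficientwise map to the domain [{poly K}]. *)
Lemma prime_poly (P : {mpoly k[N]} -> Prop) : prime_pred P ->
  prime_pred (fun f : {mpoly k[N.+1]} => forall i, P (muni f)`_i).
Proof.
move=> /prime_kernel[K [psi kerP]].
apply: (@kernel_prime _ _ (map_poly psi \o @muni N k)%FUN) => f /=.
split=> [f0 i|Pf]; first by apply/kerP; rewrite -coef_map f0 coef0.
by apply/polyP => i; rewrite coef_map coef0; apply/kerP.
Qed.

Lemma ht_chain_poly m (P : {mpoly k[N]} -> Prop) : ht_chain m P ->
  ht_chain m (fun f : {mpoly k[N.+1]} => forall i, P (muni f)`_i).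
Proof.
elim: m P => [|m IHm] P; first by case=> /prime_poly Pp _; split.
case=> Pp [P' [/IHm P'm P'P [x [Px nP'x]]]]; split; first exact: prime_poly.
exists (fun f => forall i, P' (muni f)`_i); split=> // [f P'f i|]; first exact: P'P.
have [P0 _ _ _ _] := Pp.
exists (mwiden x); rewrite muni_mwiden; split=> [i|/(_ 0%N)]; rewrite coefC //.
by case: ifP.
Qed.

Variables (K : fieldType) (psi : {rmorphism {mpoly k[N.+1]} -> K}).
Let psi0 : {rmorphism {mpoly k[N]} -> K} := (psi \o @mwiden N k)%FUN.
Let b := psi 'X_ord_max.

Lemma rmorph_muni (f : {mpoly k[N.+1]}) : psi f = (map_poly psi0 (muni f)).[b].
Proof.
apply: (@rmorph_mpoly_eq k _ _ psi
  (horner_eval b \o map_poly psi0 \o @muni N k)%FUN) => [c|i] /=.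
  by rewrite muniC map_polyC /horner_eval hornerC /= mwidenC.
have [->|[j ->]] := ord_wid i.
  by rewrite muni_max map_polyX /horner_eval hornerX.
by rewrite muni_widen map_polyC /horner_eval hornerC /= mwiden_var.
Qed.

Lemma tan_along_mwiden (u : 'rV[K]_N.+1) f :
  tan_along psi u (mwiden f) = tan_along psi0 (\row_l u 0 (wid l)) f.
Proof.
rewrite -[LHS]/((tan_along psi u \o @mwiden N k)%FUN f).
rewrite (derivation_tan_along (psi := psi0)) => [|p q|p q|c] /=.
- by congr (tan_along _ _ _); apply/rowP => l; rewrite !mxE mwiden_var tan_alongX.
- by rewrite rmorphD tan_alongD.
- by rewrite rmorphM tan_alongM.
- by rewrite mwidenC tan_alongC.
Qed.

(** For a last coordinate algebraic over the others: a tangent vector supported on it must vanish,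
    because the derivative of the minimal polynomial is nonzero at [b]. *)
Lemma tan_along_of_uni (u : 'rV[K]_N.+1) (q : {poly {mpoly k[N]}}) : (forall l, u 0 (wid l) = 0) ->
  tan_along psi u (of_uni q) = (map_poly psi0 q^`()).[b] * u 0 ord_max.
Proof.
move=> u0.
have uC c : tan_along psi u (mwiden c) = 0.
  by rewrite tan_along_mwiden /tan_along big1 // => l _; rewrite mxE u0 mul0r.
elim/poly_ind: q => [|q c IHq].
  rewrite deriv0 /of_uni rmorph0 !horner0 /tan_along big1 ?rmorph0 ?horner0 ?mul0r //.
  by move=> l _; rewrite linear0 rmorph0 mulr0.
rewrite {1}/of_uni rmorphD rmorphM /= map_polyX map_polyC hornerMXaddC.
rewrite tan_alongD uC addr0 tan_alongM tan_alongX IHq.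
rewrite -[psi _]/(psi (of_uni q)) rmorph_muni of_uniK.
rewrite derivD derivM derivX derivC addr0 mulr1 rmorphD rmorphM /= map_polyX.
by rewrite hornerD hornerMX; ring.
Qed.

End LastVariable.

Lemma tan_alongE (k : idomainType) (K : fieldType) N (psi : {mpoly k[N]} -> K) u f :
  tan_along psi u f = (u *m (\col_l psi f^`M(l))) 0 0.
Proof. by rewrite mxE; apply: eq_bigr => l _; rewrite mxE. Qed.

Lemma tangent_row_space (k : idomainType) (K : fieldType) N (psi : {mpoly k[N]} -> K)
    r (U : 'M[K]_(r, N)) :
  (forall i, tangent psi (row i U)) -> forall u, (u <= U)%MS -> tangent psi u.
Proof.
move=> tU u /submxP[v ->] f f0; rewrite tan_alongE -mulmxA.
suff -> : U *m (\col_l psi f^`M(l)) = 0 by rewrite mulmx0 mxE.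
apply/colP => i; have := tU i f f0; rewrite tan_alongE -row_mul !mxE => rU.
by rewrite -[RHS]rU.
Qed.

(** * Height and dimension of the tangent space *)

Section Dimension.
Variable k : fieldType.
Hypothesis char0 : forall n, n.+1%:R != 0 :> k.

Lemma rmorph_char0 N (K : fieldType) (psi : {rmorphism {mpoly k[N]} -> K}) n :
  n.+1%:R != 0 :> K.
Proof.
have -> : n.+1%:R = (psi \o @mpolyC N k)%FUN n.+1%:R by rewrite rmorph_nat.
by rewrite fmorph_eq0.
Qed.

(** The family [theta 'X_i] is algebraically independent modulo the kernel of [psi]. *)
Definition indep d N (K : fieldType) (psi : {mpoly k[N]} -> K)
    (theta : {mpoly k[d]} -> {mpoly k[N]}) : Prop :=
  (forall c, theta c%:MP = c%:MP) /\ forall p, psi (theta p) = 0 -> p = 0.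

(* Appends [f] to the family of elements [theta 'X_i]. *)
Definition indep_rcons d N (theta : {rmorphism {mpoly k[d]} -> {mpoly k[N]}}) f :
    {rmorphism {mpoly k[d.+1]} -> {mpoly k[N]}} :=
  (horner_eval f \o map_poly theta \o @muni d k)%FUN.

Lemma indep_rconsC d N (theta : {rmorphism {mpoly k[d]} -> {mpoly k[N]}}) f :
  (forall c, theta c%:MP = c%:MP) -> forall c, indep_rcons theta f c%:MP = c%:MP.
Proof. by move=> tC c; rewrite /= muniC map_polyC /horner_eval hornerC /= tC. Qed.

(* A relation killed by [psi'] has constant coefficient killed by [psi], so it is
   divisible by the variable, which [psi'] does not kill. *)
Lemma indep_grow d N (K K' : fieldType) (psi : {rmorphism {mpoly k[N]} -> K})
    (psi' : {rmorphism {mpoly k[N]} -> K'})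
    (theta : {rmorphism {mpoly k[d]} -> {mpoly k[N]}}) f :
  (forall x, psi' x = 0 -> psi x = 0) -> psi f = 0 -> psi' f <> 0 ->
  indep psi theta -> indep psi' (indep_rcons theta f).
Proof.
move=> ker_le f0 f'n0 [tC t_inj]; split; first exact: indep_rconsC.
suff poly0 (q : {poly {mpoly k[d]}}) : psi' (map_poly theta q).[f] = 0 -> q = 0.
  by move=> p /poly0/muni_inj.
elim/poly_ind: q => [//|q c IHq].
rewrite rmorphD rmorphM /= map_polyX map_polyC hornerMXaddC => /[dup] qc0 /ker_le.
rewrite rmorphD rmorphM f0 mulr0 add0r /= => /t_inj c0.
move: qc0; rewrite c0 polyC0 addr0 raddf0 addr0 rmorphM => /eqP.
by rewrite mulf_eq0 => /orP[/eqP/IHq ->|/eqP //]; rewrite mul0r.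
Qed.

(** Going down the chain, each strict inclusion provides an element of the larger prime outside the
    smaller one, which [indep_grow] adjoins to the family. This will bound the length of chains. *)
Lemma chain_indep m d N (K : fieldType) (psi : {rmorphism {mpoly k[N]} -> K})
    (theta : {rmorphism {mpoly k[d]} -> {mpoly k[N]}}) :
  ht_chain m (fun x => psi x = 0) -> indep psi theta ->
  exists (K' : fieldType) (psi' : {rmorphism {mpoly k[N]} -> K'})
    (theta' : {rmorphism {mpoly k[m + d]} -> {mpoly k[N]}}), indep psi' theta'.
Proof.
elim: m d K psi theta => [|m IHm] d K psi theta; first by exists K, psi, theta.
case=> _ [P' [P'm P'P [x [x0 nP'x]]]] ind.
have [K' [psi' kerP']] := prime_kernel (ht_chain_prime P'm).
have {}ind := indep_grow (f := x) (fun y Py => P'P y ((kerP' y).1 Py)) x0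
  (fun Px => nP'x ((kerP' x).1 Px)) ind.
rewrite addSnnS; apply: (IHm _ _ psi') ind.
by rewrite (pred_ext kerP').
Qed.

(** As [psi \o theta] has zero kernel, every vector is tangent to it. Lifting the standard basis
    gives tangent vectors dual to the differentials of the [theta 'X_i], hence linearly
    independent. *)
Lemma indep_tangent d N (K : fieldType) (psi : {rmorphism {mpoly k[N]} -> K})
    (theta : {rmorphism {mpoly k[d]} -> {mpoly k[N]}}) : indep psi theta ->
  exists U : 'M[K]_(d, N), row_free U /\ forall u, (u <= U)%MS -> tangent psi u.
Proof.
case=> tC t_inj; have K0 := rmorph_char0 psi.
have lift i : exists u, tangent psi u /\
    forall j, tan_along psi u (theta 'X_j) = (i == j)%:R.
  pose chi : {rmorphism {mpoly k[d]} -> K} := (psi \o theta)%FUN.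
  have chiC c : chi c%:MP = psi c%:MP by rewrite /= tC.
  have chiX j : chi 'X_j * psi 1 = psi (theta 'X_j) by rewrite rmorph1 mulr1.
  have t_chi : tangent chi (delta_mx 0 i).
    move=> f /t_inj ->; rewrite /tan_along big1 // => l _.
    by rewrite linear0 rmorph0 mulr0.
  have [u [tu uE]] := tangent_lift K0 chiC chiX t_chi.
  exists u; split=> // j; rewrite -uE -mpolyC1 tan_alongC mulr0 addr0.
  by rewrite mpolyC1 rmorph1 mulr1 mxE /= eq_sym.
have [u uP] := choice lift.
exists (\matrix_i u i); split; last first.
  by apply: tangent_row_space => i; rewrite rowK; case: (uP i).
apply/row_freeP; exists (\matrix_(l, j) psi (theta 'X_j)^`M(l)).
apply/matrixP => i j; rewrite !mxE -(uP i).2 /tan_along; apply: eq_bigr => l _.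
by rewrite !mxE.
Qed.

(** Induction on [N]. Forgetting the last coordinate, by the matrix [pi], maps tangent vectors at
    [psi] to tangent vectors at [psi0], so the rank grows at most by the dimension of the kernel: a
    line if the last coordinate [b] is transcendental over the others, zero if it is algebraic. *)
Lemma chain_and_indep N (K : fieldType) (psi : {rmorphism {mpoly k[N]} -> K}) :
  exists m d (theta : {rmorphism {mpoly k[d]} -> {mpoly k[N]}}),
    [/\ (m + d)%N = N, ht_chain m (fun x => psi x = 0), indep psi theta &
        forall r (W : 'M[K]_(r, N)), (forall u, (u <= W)%MS -> tangent psi u) ->
          (\rank W <= d)%N].
Proof.
elim: N psi => [|N IHN] psi.
  exists 0%N, 0%N, idfun; split=> //; [| |by move=> r W _; apply: rank_leq_col].
    by split=> //; apply: (@kernel_prime _ _ psi).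
  split=> // p /= p0.
  have [c pE] : exists c, p = c%:MP.
    elim/mpoly_ringind: p {p0} => [c|[]//|p q [c ->] [c' ->]|p q [c ->] [c' ->]].
    - by exists c.
    - by exists (c + c'); rewrite mpolyCD.
    - by exists (c * c'); rewrite mpolyCM.
  move: p0; rewrite pE -[psi _]/((psi \o @mpolyC 0 k)%FUN c) => /eqP.
  by rewrite fmorph_eq0 => /eqP ->; rewrite mpolyC0.
pose psi0 : {rmorphism {mpoly k[N]} -> K} := (psi \o @mwiden N k)%FUN.
pose b := psi 'X_ord_max.
have [m [d [theta [md chm [tC t_inj] rkW]]]] := IHN psi0.
have K0 := rmorph_char0 psi.
pose pi := \matrix_(i < N.+1, j < N) (i == widen_ord (leqnSn N) j)%:R : 'M[K]_(N.+1, N).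
have piE (u : 'rV_N.+1) : u *m pi = \row_j u 0 (widen_ord (leqnSn N) j).
  apply/rowP => j; rewrite !mxE (bigD1 (widen_ord (leqnSn N) j)) //= big1 => [|i ij].
    by rewrite mxE eqxx mulr1 addr0.
  by rewrite mxE (negPf ij) mulr0.
have rk_pi r (W : 'M[K]_(r, N.+1)) : (forall u, (u <= W)%MS -> tangent psi u) ->
    (\rank (W *m pi) <= d)%N.
  move=> tW; apply: rkW => _ /submxP[v ->] f f0; rewrite mulmxA piE.
  by rewrite -tan_along_mwiden; apply: tW; rewrite ?submxMl.
have [trans|alg] := pselect (forall q : {poly {mpoly k[N]}},
    (map_poly psi0 q).[b] = 0 -> map_poly psi0 q = 0).
  (* Transcendental case: the kernel of [psi] is the extension of that of [psi0], so the chain keeps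
     its length and the last variable joins the independent family. *)
  exists m, d.+1, (indep_rcons (@mwiden N k \o theta)%FUN 'X_ord_max).
  split; first by rewrite addnS md.
  - rewrite (_ : (fun x => _) = fun f => forall i, psi0 (muni f)`_i = 0).
      exact: (ht_chain_poly (P := fun x => psi0 x = 0)).
    apply: pred_ext => f; rewrite rmorph_muni -/psi0 -/b; split=> [/trans f0 i|f0].
      by rewrite -coef_map f0 coef0.
    rewrite (_ : map_poly _ _ = 0) ?horner0 //; apply/polyP => i.
    by rewrite coef_map coef0; exact: f0.
  - split; first by apply: indep_rconsC => c; rewrite /= tC mwidenC.
    move=> p p0.
    have q0 : map_poly psi0 (map_poly theta (muni p)) = 0.
      apply: trans; rewrite -[RHS]p0 /= /horner_eval /b -horner_map -!map_poly_comp.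
      by congr (_.[_]); apply: eq_map_poly.
    apply: muni_inj; apply/polyP => i; rewrite coef0; apply: t_inj.
    by have /polyP/(_ i) := q0; rewrite !coef_map coef0.
  - move=> r W tW; rewrite -(mxrank_mul_ker W pi) -[d.+1]addn1 leq_add ?rk_pi //.
    apply: leq_trans (mxrankS (capmxSr _ _)) _.
    rewrite -[X in (_ <= X)%N](mxrank_delta K (n := N.+1) (0 : 'I_1) ord_max).
    apply: mxrankS; apply/rV_subP => u /sub_kermxP; rewrite piE => u0.
    apply/submxP; exists (u 0 ord_max)%:M; rewrite mul_scalar_mx; apply/rowP => i.
    rewrite !mxE /=; have [->|[j ->]] := ord_wid i; first by rewrite eqxx mulr1.
    have /rowP/(_ j) := u0; rewrite !mxE => ->.
    by rewrite -val_eqE /= ltn_eqF // mulr0.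
move: alg => /existsNP[g0 /not_implyP[g0b /eqP g0n0]].
have [g [gb lg g'b _]] := minpoly_along K0 g0n0 g0b.
(* Algebraic case: the extension of the kernel of [psi0] lies strictly below the kernel of [psi],
   since it omits [g], whose leading coefficient is not killed. *)
exists m.+1, d, (@mwiden N k \o theta)%FUN; split; first by rewrite addSn md.
- split; first exact: (@kernel_prime _ _ psi).
  exists (fun f => forall i, psi0 (muni f)`_i = 0); split;
    first exact: (ht_chain_poly (P := fun x => psi0 x = 0)).
    move=> f f0; rewrite rmorph_muni -/psi0 -/b.
    rewrite (_ : map_poly _ _ = 0) ?horner0 //; apply/polyP => i.
    by rewrite coef_map coef0; exact: f0.
  exists (of_uni g); rewrite rmorph_muni of_uniK; split=> // /(_ (size g).-1) lg0.
  by move/eqP: lg; apply; exact: lg0.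
- by split=> // c; rewrite /= tC mwidenC.
move=> r W tW; rewrite -(mxrank_mul_ker W pi) [X in (_ + X)%N](_ : _ = 0%N) ?addn0 ?rk_pi //.
apply/eqP; rewrite mxrank_eq0 -submx0; apply/rV_subP => u.
rewrite sub_capmx => /andP[/tW tu /sub_kermxP]; rewrite piE => u0.
have u0' l : u 0 (widen_ord (leqnSn N) l) = 0 by have /rowP/(_ l) := u0; rewrite !mxE.
suff -> : u = 0 by rewrite sub0mx.
apply/rowP => i; rewrite mxE; have [->|[j ->//]] := ord_wid i.
have := tu (of_uni g); rewrite rmorph_muni of_uniK => /(_ gb)/eqP.
by rewrite tan_along_of_uni // mulf_eq0 (negPf g'b) => /eqP.
Qed.

(** The height is [N - d]: one chain has length [h = N - d], and a longer one would yield more than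
    [N] independent elements, hence too many independent tangent vectors. *)
Lemma height_tangent N (K : fieldType) (psi : {rmorphism {mpoly k[N]} -> K}) :
  exists d (U : 'M[K]_(d, N)),
    [/\ forall m, ht_chain m (fun x => psi x = 0) <-> (m + d <= N)%N, row_free U &
        forall u, tangent psi u <-> (u <= U)%MS].
Proof.
have [h [d [theta [hd chh ind rkW]]]] := chain_and_indep psi.
have [U [freeU tU]] := indep_tangent ind.
exists d, U; split=> // [m|u]; split=> //.
- move=> chm; have [K' [psi' [theta' ind']]] := chain_indep chm ind.
  have [U' [/eqP rkU' _]] := indep_tangent ind'.
  by have := rank_leq_col U'; rewrite rkU'.
- move=> le_mN; apply: ht_chain_leq chh.
  by rewrite -(leq_add2r d) hd.
(* Stacking [u] under [U] cannot raise the rank above the bound [d], so [u] already lies in the row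
   space of [U]. *)
- move=> tu; have tUu v : (v <= col_mx U u)%MS -> tangent psi v.
    apply: tangent_row_space => {v} i; case: (splitP i) => j ij.
      rewrite (_ : i = lshift 1 j) ?rowKu; last exact/val_inj.
      exact/tU/row_sub.
    rewrite (_ : i = rshift d j); last exact/val_inj.
    by rewrite rowKd row_id.
  have le_rk : (\rank (col_mx U u) <= \rank U)%N by rewrite (eqP freeU) rkW.
  have sub : (U <= col_mx U u)%MS.
    by apply/submxP; exists (row_mx 1%:M 0); rewrite mul_row_col mul1mx mul0mx addr0.
  have [_] := mxrank_leqif_sup sub.
  rewrite eqn_leq le_rk mxrankS // => /esym sub'.
  apply: submx_trans sub'.
  by apply/submxP; exists (row_mx 0 1%:M); rewrite mul_row_col mul1mx mul0mx add0r.
- exact: tU.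
Qed.

End Dimension.

(** * Localizations *)

Section Localization.
Variables (A : comNzRingType) (F : fieldType) (theta : {rmorphism A -> F}).
Hypothesis theta_inj : forall a, theta a = 0 -> a = 0.
Variable M : A -> Prop.
Hypotheses (M1 : M 1) (MM : forall a b, M a -> M b -> M (a * b)) (M0 : ~ M 0).

(** Used for [A_gamma], and with [M] reduced to [1] for the image of [theta], which covers
    [C_gamma]. *)
Definition loc (x : F) : Prop := exists a m, M m /\ x = theta a / theta m.

Let M_neq0 m : M m -> theta m != 0.
Proof. by move=> Mm; apply/eqP => /theta_inj m0; apply: M0; rewrite -m0. Qed.

Lemma loc_theta a : loc (theta a).
Proof. by exists a, 1; rewrite rmorph1 divr1. Qed.

Lemma locV m : M m -> loc (theta m)^-1.
Proof. by move=> Mm; exists 1, m; rewrite rmorph1 mul1r. Qed.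

Lemma locD x y : loc x -> loc y -> loc (x + y).
Proof.
move=> [a [m [Mm ->]]] [b [l [Ml ->]]]; exists (a * l + b * m), (m * l).
by split; [exact: MM | rewrite addf_div ?M_neq0 // rmorphD !rmorphM].
Qed.

Lemma locM x y : loc x -> loc y -> loc (x * y).
Proof.
move=> [a [m [Mm ->]]] [b [l [Ml ->]]]; exists (a * b), (m * l).
by split; [exact: MM | rewrite mulf_div !rmorphM].
Qed.

Section Ideal.
Variable Q : F -> Prop.
Hypothesis Qp : is_prime loc Q.

Lemma prime_numer a m : M m -> Q (theta a / theta m) <-> Q (theta a).
Proof.
move=> Mm; have [[_ [_ [_ QM]]] _] := Qp; split=> Qa.
  rewrite -(divfK (M_neq0 Mm) (theta a)) mulrC; apply: QM => //; exact: loc_theta.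
by rewrite mulrC; apply: QM => //; apply: locV.
Qed.

Lemma prime_contract : prime_pred (fun a => Q (theta a)).
Proof.
have [[QR [Q0 [QD QM]]] [Q1 Qpr]] := Qp; split=> [|x y|r x||x y].
- by rewrite rmorph0.
- by rewrite rmorphD; apply: QD.
- by rewrite rmorphM; apply: QM; apply: loc_theta.
- by rewrite rmorph1.
- by rewrite rmorphM; apply: Qpr; apply: loc_theta.
Qed.

Lemma prime_denom m : M m -> ~ Q (theta m).
Proof.
move=> Mm Qm; have [_ [Q1 _]] := Qp; apply: Q1.
by rewrite -(divff (M_neq0 Mm)); apply/prime_numer.
Qed.

End Ideal.

(** [Q] consists of the fractions with numerator in [P]. Denominators lie outside the prime [P] and
    cancel, so the choice of representative does not matter. *)
Lemma loc_prime (P : A -> Prop) : prime_pred P -> (forall m, M m -> ~ P m) ->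
  exists Q, is_prime loc Q /\ forall a, Q (theta a) <-> P a.
Proof.
move=> [P0 PD PM P1 Pp] MP.
have thI a b : theta a = theta b -> a = b.
  by move=> ab; apply/eqP; rewrite -subr_eq0; apply/eqP/theta_inj; rewrite rmorphB ab subrr.
have PMr a b : P a -> P (a * b) by move=> Pa; rewrite mulrC; apply: PM.
have cancel m a : M m -> P (m * a) -> P a.
  by move=> Mm /Pp[] // Pm; case: (MP m Mm).
exists (fun x => exists a m, [/\ M m, P a & x = theta a / theta m]).
split; last first.
  move=> b; split=> [[a [m [Mm Pa bE]]]|Pb]; last by exists b, 1; rewrite rmorph1 divr1.
  apply: (cancel m) => //; rewrite (_ : m * b = a) //; apply: thI.
  by rewrite rmorphM bE mulrC divfK ?M_neq0.
split; [split; [|split; [|split]]|split].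
- by move=> x [a [m [Mm _ ->]]]; exists a, m.
- by exists 0, 1; rewrite rmorph0 mul0r.
- move=> x y [a [m [Mm Pa ->]]] [b [l [Ml Pb ->]]]; exists (a * l + b * m), (m * l).
  split; [exact: MM | by apply: PD; apply: PMr |].
  by rewrite addf_div ?M_neq0 // rmorphD !rmorphM.
- move=> x y [a [m [Mm ->]]] [b [l [Ml Pb ->]]]; exists (a * b), (m * l).
  by split; [exact: MM | exact: PM | rewrite mulf_div !rmorphM].
- move=> [a [m [Mm Pa /esym/eqP]]]; rewrite -subr_eq0.
  rewrite -[X in _ - X](divff (M_neq0 Mm)) -mulrBl mulf_eq0 invr_eq0 (negPf (M_neq0 Mm)) orbF.
  by rewrite subr_eq0 => /eqP/thI am; apply: (MP m) => //; rewrite -am.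
- move=> x y [a [m [Mm ->]]] [b [l [Ml ->]]] [c [r [Mr Pc abE]]].
  have /Pp[Pa|Pb] : P (a * b); [|by left; exists a, m|by right; exists b, l].
  apply: (cancel r) => //; rewrite (_ : r * (a * b) = m * l * c); first exact: PM.
  have [[m0 l0] r0] := (M_neq0 Mm, M_neq0 Ml, M_neq0 Mr).
  apply: thI; rewrite !rmorphM.
  transitivity (theta m * theta l * theta r * (theta a / theta m * (theta b / theta l))).
    by field; rewrite m0 l0.
  by rewrite abE; field.
Qed.

Lemma ht_ge0 Q : ht_ge loc Q 0 <-> is_prime loc Q.
Proof.
split=> [[P [/(_ 0%N isT) P0 [/pred_ext <- _]]] //|Qp].
by exists (fun=> Q); split.
Qed.

Lemma ht_geS Q m : ht_ge loc Q m.+1 <-> is_prime loc Q /\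
  exists Q', [/\ ht_ge loc Q' m, Defs.subsetP Q' Q & exists x, Q x /\ ~ Q' x].
Proof.
split=> [[P [Pp [/pred_ext <- Pst]]]|[Qp [Q' [[P [Pp [/pred_ext PQ' Pst]]] Q'Q sQ]]]].
  split; first exact: Pp; exists (P m); have [? ?] := Pst m (leqnn _).
  split=> //; exists P; split=> [j jm|]; first by apply: Pp; apply: ltnW.
  by split=> // j jm; apply: Pst; apply: ltnW.
exists (fun j => if (j <= m)%N then P j else Q); split=> [j _|].
  by case: ifP => // /Pp.
split=> [x|j]; first by rewrite ltnn.
rewrite ltnS => jm; rewrite jm; case: (ltnP j m) => [/Pst //|mj].
by have -> : j = m by [apply/eqP; rewrite eqn_leq jm]; rewrite PQ'.
Qed.

(** Primes of [loc] correspond to primes of [A] avoiding [M], and every prime below the contraction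
    of [Q] avoids [M] as well. *)
Lemma ht_ge_chain m Q : is_prime loc Q ->
  ht_ge loc Q m <-> ht_chain m (fun a => Q (theta a)).
Proof.
elim: m Q => [|m IHm] Q Qp.
  split=> [_|_]; last exact/ht_ge0.
  by split; first exact: prime_contract.
split.
  case/ht_geS => _ [Q' [Q'm Q'Q [x [Qx nQ'x]]]]; split; first exact: prime_contract.
  have Q'p : is_prime loc Q' by apply/ht_ge0; case: m Q'm {IHm} => // m /ht_geS[/ht_ge0].
  exists (fun a => Q' (theta a)); split; [exact/IHm | by move=> a /Q'Q |].
  have [[QR _] _] := Qp; have [a [l [Ml xE]]] := QR x Qx.
  exists a; split; first by apply/(prime_numer Qp a Ml); rewrite -xE.
  by move=> Q'a; apply: nQ'x; rewrite xE; apply/(prime_numer Q'p a Ml).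
case=> _ [P' [P'm P'P [a [Qa nP'a]]]]; apply/ht_geS; split=> //.
have [m0 Mm0|Q' [Q'p Q'E]] := loc_prime (ht_chain_prime P'm).
  by move=> /P'P; apply: prime_denom.
exists Q'; split; first by apply/(IHm _ Q'p); rewrite (pred_ext Q'E).
  have [[Q'R _] _] := Q'p; move=> x /[dup] Q'x /Q'R[b [l [Ml xE]]].
  by move: Q'x; rewrite xE => /(prime_numer Q'p b Ml)/Q'E/P'P/(prime_numer Qp b Ml).
by exists (theta a); split=> // /Q'E.
Qed.

End Localization.

(** * Minimal primes over an ideal invariant under a derivation *)

Section InvariantMinimalPrime.
Variables (F : fieldType) (R : F -> Prop) (D : F -> F).
Hypotheses (DD : forall x y, D (x + y) = D x + D y)
  (DM : forall x y, D (x * y) = x * D y + D x * y) (DR : forall x, R x -> R (D x))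
  (R0 : R 0) (RN1 : R (-1)) (RV : forall m, R (m.+1%:R^-1)) (char0 : forall m, m.+1%:R != 0 :> F)
  (RD : forall x y, R x -> R y -> R (x + y)) (RM : forall x y, R x -> R y -> R (x * y)).

Lemma iter_leibniz m x y :
  iter m D (x * y) = \sum_(i < m.+1) (iter i D x * iter (m - i) D y) *+ 'C(m, i).
Proof.
have D0 : D 0 = 0 by apply: (addrI (D 0)); rewrite -DD !addr0.
have Dsum (I : finType) (f : I -> F) : D (\sum_i f i) = \sum_i D (f i).
  exact: (big_morph D DD D0).
have Dmuln z i : D (z *+ i) = D z *+ i.
  by elim: i => [|i IHi]; rewrite ?mulr0n ?mulrS ?DD ?IHi.
elim: m => [|m IHm]; first by rewrite big_ord1 bin0.
rewrite iterS IHm Dsum.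
under eq_bigr => i _ do rewrite Dmuln DM mulrnDl.
rewrite big_split /= big_ord_recl [X in _ + X]big_ord_recr /=.
rewrite !bin0 !binn !subn0 !subnn [RHS]big_ord_recl [X in _ = _ + X]big_ord_recr /=.
rewrite bin0 /bump /= !add1n !binn subnn -!addrA; congr (_ + _).
rewrite !addrA; congr (_ + _); rewrite -big_split; apply: eq_bigr => i _ /=.
rewrite !add1n add0n binS mulrnDr; congr (_ *+ _ + _).
by rewrite subSS -(subnSK (ltn_ord i)) iterS.
Qed.

(* The largest [D]-invariant ideal contained in a prime is prime. *)
Lemma minimal_prime_invariant (J Q : F -> Prop) :
  (forall x, J x -> J (D x)) -> minimal_prime_over R J Q -> forall x, Q x -> Q (D x).
Proof.
move=> DJ [[[QR [Q0 [QD QM]]] [Q1 Qp]] [JQ Qmin]].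
pose Q' x := R x /\ forall m, Q (iter m D x).
have D0 : D 0 = 0 by apply: (addrI (D 0)); rewrite -DD !addr0.
have Riter m x : R x -> R (iter m D x) by move=> Rx; elim: m => //= m; apply: DR.
have itD m x y : iter m D (x + y) = iter m D x + iter m D y.
  by elim: m => //= m ->; rewrite DD.
have Q'p : is_prime R Q'.
  split; [split; [|split; [|split]]|split].
  - by move=> x [].
  - by split=> // m; rewrite (_ : iter m D 0 = 0) //; elim: m => //= m ->.
  - by move=> x y [Rx Qx] [Ry Qy]; split=> [|m]; [exact: RD | rewrite itD; apply: QD].
  - move=> r x Rr [Rx Qx]; split=> [|m]; first exact: RM.
    elim: m r x Rr Rx Qx => [|m IHm] r x Rr Rx Qx; first by apply: QM => //; apply: (Qx 0%N).
    rewrite iterSr DM itD; apply: QD; last by apply: IHm => //; apply: DR.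
    apply: IHm => // [|l]; first exact: DR.
    by rewrite -iterSr.
  - by move=> [_ /(_ 0%N)].
  move=> x y Rx Ry [_ Qxy].
  have [Qx|/existsNP[m Qx]] := pselect (forall m, Q (iter m D x)); first by left.
  have [Qy|/existsNP[l Qy]] := pselect (forall m, Q (iter m D y)); first by right.
  have first_out z r : ~ Q (iter r D z) ->
      exists i, ~ Q (iter i D z) /\ forall j, (j < i)%N -> Q (iter j D z).
    move=> Qz; have ex : exists i, `[< ~ Q (iter i D z) >] by exists r; apply/asboolP.
    case: (ex_minnP ex) => i /asboolP Qi imin; exists i; split=> // j ji.
    by apply: contrapT => /asboolP/imin; rewrite leqNgt ji.
  have [i [Qi xi]] := first_out _ _ Qx; have [j [Qj yj]] := first_out _ _ Qy.
  (* The orders [i] and [j] are least, so every term of the Leibniz sum other than the one at [i]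
     has a factor in [Q]. The binomial coefficient of that term is invertible in [R]. *)
  exfalso; have := Qxy (i + j)%N; rewrite iter_leibniz.
  have i_lt : (i < (i + j).+1)%N by rewrite ltnS leq_addr.
  rewrite (bigD1 (Ordinal i_lt)) //= addKn.
  set z := _ *+ _; set w := \sum_(_ | _) _ => Qzw.
  have QN u : Q u -> Q (- u) by move=> Qu; rewrite -mulN1r; apply: QM.
  have QMn u c : Q u -> Q (u *+ c).
    by move=> Qu; elim: c => [|c IHc]; rewrite ?mulr0n ?mulrS //; apply: QD.
  have Qw : Q w.
    apply: (big_ind Q) => // -[a a_lt] /=; rewrite -val_eqE /= => ai; apply: QMn.
    move: ai; rewrite neq_ltn => /orP[ai|ia].
      by rewrite mulrC; apply: QM; [apply: Riter | apply: xi].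
    by apply: QM; [apply: Riter | apply: yj; rewrite ltn_subLR // ltn_add2r].
  have Qz : Q z by rewrite -(addrK w z); apply: QD => //; apply: QN.
  have [c cE] : exists c, 'C(i + j, i) = c.+1.
    by exists 'C(i + j, i).-1; rewrite prednK // bin_gt0 leq_addr.
  have : Q (iter i D x * iter j D y).
    rewrite (_ : _ * _ = c.+1%:R^-1 * z); first exact: QM.
    have zE : z = c.+1%:R * (iter i D x * iter j D y) by rewrite mulr_natl -cE.
    by rewrite zE mulKf.
  by case/Qp => //; apply: Riter.
have Q'J : Defs.subsetP J Q'.
  move=> x Jx; split; first exact/QR/JQ.
  by move=> m; apply: JQ; elim: m => //= m; apply: DJ.
have Q'Q : Defs.subsetP Q' Q by move=> x [_ /(_ 0%N)].
by move=> x /(Qmin _ Q'p Q'J Q'Q)[_ /(_ 1%N)].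
Qed.
End InvariantMinimalPrime.

(** * The Jacobian map between tangent spaces *)

Section Fibration.
Variable k : fieldType.
Hypothesis char0 : forall n, n.+1%:R != 0 :> k.
Variables (m N : nat) (K : fieldType).
Variables (psi : {rmorphism {mpoly k[N]} -> K}) (chi : {rmorphism {mpoly k[m]} -> K}).
Variables (num den : 'I_m -> {mpoly k[N]}).
Hypotheses (chiC : forall c, chi c%:MP = psi c%:MP)
  (chiX : forall j, chi 'X_j * psi (den j) = psi (num j))
  (den_neq0 : forall j, psi (den j) != 0).

(** The quotient rule for [num j / den j] at [psi], with [chi 'X_j] as the value of the quotient;
    row vectors are multiplied from the left. *)
Definition quot_jacobian : 'M[K]_(N, m) := \matrix_(l, j)
  ((psi (num j)^`M(l) - chi 'X_j * psi (den j)^`M(l)) / psi (den j)).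

Lemma quot_jacobianE u j : (u *m quot_jacobian) 0 j =
  (tan_along psi u (num j) - chi 'X_j * tan_along psi u (den j)) / psi (den j).
Proof.
rewrite mxE mulr_sumr -sumrB mulr_suml; apply: eq_bigr => l _; rewrite !mxE; ring.
Qed.

Lemma tangent_push u : tangent psi u -> tangent chi (u *m quot_jacobian).
Proof.
move=> tu p p0; set w := u *m _.
have wE j : w 0 j * psi (den j) + chi 'X_j * tan_along psi u (den j) =
    tan_along psi u (num j).
  by rewrite quot_jacobianE divfK ?den_neq0 // subrK.
(* Substituting the quotients in [p] gives a fraction [a / e]. The second identity is the derivative
   of the first, and [psi a = 0] once [chi p = 0]. *)
suff [a [e [e0 ae dae]]] : exists a e, [/\ psi e != 0, chi p * psi e = psi a &
    tan_along chi w p * psi e + chi p * tan_along psi u e = tan_along psi u a].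
  move: dae; rewrite p0 mul0r addr0 tu -?ae ?p0 ?mul0r // => /eqP.
  by rewrite mulf_eq0 (negPf e0) orbF => /eqP.
elim/mpoly_ringind: p {p0} => [c|j|p q [a [e [e0 ae dae]]] [b [f [f0 bf dbf]]]
    |p q [a [e [e0 ae dae]]] [b [f [f0 bf dbf]]]].
- exists c%:MP, 1; rewrite rmorph1 oner_neq0 !mulr1 chiC; split=> //.
  by rewrite -mpolyC1 !tan_alongC mulr0 addr0.
- by exists (num j), (den j); rewrite tan_alongX.
- exists (a * f + b * e), (e * f).
  rewrite rmorphM mulf_neq0 // !rmorphD !rmorphM -ae -bf; split=> //; first by ring.
  by rewrite !tan_alongD !tan_alongM -dae -dbf -ae -bf; ring.
- exists (a * b), (e * f).
  rewrite rmorphM mulf_neq0 // !rmorphM -ae -bf; split=> //; first by ring.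
  by rewrite !tan_alongM -dae -dbf -ae -bf; ring.
Qed.

(** Rank-nullity on the tangent space of [psi]: [tangent_push] places the image inside the tangent
    space of [chi], and [tangent_lift] shows that it is everything. *)
Lemma tangent_fibration d d' (U : 'M[K]_(d, N)) (U' : 'M[K]_(d', m)) :
  row_free U -> (forall u, tangent psi u <-> (u <= U)%MS) ->
  row_free U' -> (forall u, tangent chi u <-> (u <= U')%MS) ->
  d = (d' + \rank (U :&: kermx quot_jacobian)%MS)%N.
Proof.
move=> /eqP rkU tU /eqP rkU' tU'; rewrite -{1}rkU -(mxrank_mul_ker U quot_jacobian).
congr (_ + _)%N; rewrite -[RHS]rkU'; apply/eqP.
rewrite eqn_leq; apply/andP; split; apply: mxrankS; apply/rV_subP => w.
  by case/submxP => v ->; rewrite mulmxA; apply/tU'/tangent_push/tU; rewrite submxMl.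
move/tU' => /(tangent_lift (rmorph_char0 char0 psi) chiC chiX)[u [/tU uU uE]].
rewrite (_ : w = u *m quot_jacobian) ?submxMr //; apply/rowP => j.
by rewrite quot_jacobianE -uE addrK mulfK.
Qed.

End Fibration.

(** * The bracket on the fraction field *)

Section TwoRowDeterminant.
Variable n : nat.
Hypothesis n_gt1 : (1 < n)%N.

(** Same row layout as [jac_args]; the default [0] is never reached when [1 < n]. *)
Definition bracket_mx (R : comNzRingType) (r r' : 'I_n -> R) (X : 'I_(n - 2) -> 'I_n -> R) :
    'M[R]_n :=
  \matrix_(i, l) (if val i == 0%N then r l else if val i == 1%N then r' l
    else oapp (fun j => X j l) 0 (insub (val i - 2)%N)).

Definition ord_fst : 'I_n := Ordinal (ltnW n_gt1).
Definition ord_snd : 'I_n := Ordinal n_gt1.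

Lemma ord_shift_subproof (j : 'I_(n - 2)) : (j.+2 < n)%N.
Proof. by have := ltn_ord j; rewrite ltn_subRL add2n. Qed.
Definition ord_shift j : 'I_n := Ordinal (ord_shift_subproof j).

Lemma insub_shift (j : 'I_(n - 2)) : insub (j.+2 - 2)%N = Some j.
Proof. by rewrite (_ : (j.+2 - 2)%N = j) ?valK // !subSS subn0. Qed.

Variant bracket_ord : 'I_n -> Prop :=
| BracketFst : bracket_ord ord_fst
| BracketSnd : bracket_ord ord_snd
| BracketShift j : bracket_ord (ord_shift j).

Lemma bracket_ordP i : bracket_ord i.
Proof.
have [i0|i_gt0] := posnP i.
  by rewrite (_ : i = ord_fst); [constructor | apply/val_inj].
have [i1|i_neq1] := eqVneq (val i) 1%N.
  by rewrite (_ : i = ord_snd); [constructor | apply/val_inj].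
have i2 : (2 <= i)%N by rewrite ltn_neqAle eq_sym i_neq1.
have lt_i : (i - 2 < n - 2)%N by rewrite ltn_sub2r // (leq_ltn_trans i2).
rewrite (_ : i = ord_shift (Ordinal lt_i)); first by constructor.
by apply/val_inj; rewrite /= -addn2 subnK.
Qed.

Section Ring.
Variable R : comNzRingType.
Implicit Types (r : 'I_n -> R) (X : 'I_(n - 2) -> 'I_n -> R).

Lemma bracket_mx_shift r r' X j l : bracket_mx r r' X (ord_shift j) l = X j l.
Proof. by rewrite mxE /= insub_shift. Qed.

Let delta (l i : 'I_n) : R := (l == i)%:R.

Lemma det_delta_row (B C : 'M[R]_n) i l :
  (forall l', C i l' = delta l l') -> (forall i' l', i' != i -> C i' l' = B i' l') ->
  \det C = cofactor B i l.
Proof.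
move=> Ci CB; rewrite (expand_det_row C i) (bigD1 l) //= big1 => [|l' ll'].
  rewrite Ci /delta eqxx mul1r addr0 /cofactor; congr (_ * \det _).
  by apply/matrixP => a b; rewrite !mxE CB // eq_sym neq_lift.
by rewrite Ci /delta eq_sym (negPf ll') mul0r.
Qed.

Lemma det_bracket_fst r r' X :
  \det (bracket_mx r r' X) = \sum_l r l * \det (bracket_mx (delta l) r' X).
Proof.
rewrite (expand_det_row _ ord_fst); apply: eq_bigr => l _; rewrite mxE; congr (_ * _).
apply/esym/det_delta_row => [l'|i' l']; first by rewrite mxE.
by rewrite -val_eqE !mxE => /= /negPf ->.
Qed.

Lemma det_bracket_snd r r' X :
  \det (bracket_mx r r' X) = \sum_l r' l * \det (bracket_mx r (delta l) X).
Proof.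
rewrite (expand_det_row _ ord_snd); apply: eq_bigr => l _; rewrite mxE; congr (_ * _).
apply/esym/det_delta_row => [l'|i' l']; first by rewrite mxE.
by rewrite -val_eqE !mxE => /= /negPf ->.
Qed.

Lemma det_bracket2 r r' X : \det (bracket_mx r r' X) =
  \sum_l \sum_l' r l * r' l' * \det (bracket_mx (delta l) (delta l') X).
Proof.
rewrite det_bracket_fst; apply: eq_bigr => l _.
rewrite det_bracket_snd mulr_sumr; apply: eq_bigr => l' _; exact: mulrA.
Qed.

Lemma det_bracket_same r X : \det (bracket_mx r r X) = 0.
Proof. by apply: (@determinant_alternate _ _ _ ord_fst ord_snd) => // l; rewrite !mxE. Qed.

Lemma det_bracket_X r X j : \det (bracket_mx (X j) r X) = 0.
Proof.
apply: (@determinant_alternate _ _ _ ord_fst (ord_shift j)) => // l.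
by rewrite bracket_mx_shift mxE.
Qed.

Lemma det_bracketC r r' X : \det (bracket_mx r r' X) = - \det (bracket_mx r' r X).
Proof.
rewrite (_ : bracket_mx r r' X = xrow ord_fst ord_snd (bracket_mx r' r X)).
  by rewrite xrowE det_mulmx det_perm odd_tperm expr1 mulN1r.
apply/matrixP => i l; rewrite [RHS]mxE.
case: (bracket_ordP i) => [||j]; rewrite ?tpermL ?tpermR ?mxE //.
by rewrite tpermD ?mxE // -val_eqE.
Qed.

Lemma det_bracket_scale r r' X (c : 'I_(n - 2) -> R) :
  \det (bracket_mx r r' (fun j l => c j * X j l)) =
    (\prod_j c j) * \det (bracket_mx r r' X).
Proof.
pose c' i := if (i < 2)%N then 1 else oapp c 1 (insub (i - 2)%N).
rewrite (_ : bracket_mx _ _ _ = diag_mx (\row_(i < n) c' i) *m bracket_mx r r' X).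
  rewrite det_mulmx det_diag; congr (_ * _).
  under eq_bigr do rewrite mxE.
  rewrite -(big_mkord predT c') (@big_cat_nat _ _ _ 2) //= !big_nat_recl //= big_geq //.
  rewrite !mul1r -{1}[2%N]add0n big_addn big_mkord; apply: eq_bigr => j _.
  by rewrite /c' addn2 /= insub_shift.
apply/matrixP => i l; rewrite mul_diag_mx !mxE /c'.
case: (bracket_ordP i) => [||j] /=; rewrite ?mul1r //.
by rewrite !insub_shift.
Qed.

End Ring.

Lemma det_bracket_morph (R S : comNzRingType) (f : {rmorphism R -> S}) r r' X :
  f (\det (bracket_mx r r' X)) =
    \det (bracket_mx (f \o r)%FUN (f \o r')%FUN (fun j l => f (X j l))).
Proof.
rewrite -det_map_mx; congr (\det _); apply/matrixP => i l; rewrite !mxE.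
case: ifP => // _; case: ifP => // _.
by case: insub => //=; rewrite rmorph0.
Qed.

End TwoRowDeterminant.

Section QuotientRule.
Variable K : fieldType.
Implicit Types a b c d p q : K.

Lemma quot_rule_rep p q a b dp dq da db : q != 0 -> b != 0 -> p / q = a / b ->
  dp * b + p * db = da * q + a * dq ->
  (da * b - a * db) / b ^+ 2 = (dp - p / q * dq) / q.
Proof.
move=> q0 b0 E dE; have aE : a = p / q * b by rewrite E divfK.
have -> : da = (dp * b + p * db - a * dq) / q by rewrite dE addrK mulfK.
by rewrite aE; field; rewrite q0 b0.
Qed.

Lemma quot_rule_add a b c d da db dc dd : b != 0 -> d != 0 ->
  (da * d + a * dd + (dc * b + c * db) - (a * d + c * b) / (b * d) * (db * d + b * dd)) / (b * d)
  = (da - a / b * db) / b + (dc - c / d * dd) / d.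
Proof. by move=> b0 d0; field; rewrite ?b0 ?d0. Qed.

Lemma quot_rule_mul a b c d da db dc dd : b != 0 -> d != 0 ->
  (da * c + a * dc - (a * c) / (b * d) * (db * d + b * dd)) / (b * d)
  = a / b * ((dc - c / d * dd) / d) + (da - a / b * db) / b * (c / d).
Proof. by move=> b0 d0; field; rewrite ?b0 ?d0. Qed.

Lemma quot_rule_sqr a b da db : b != 0 ->
  (da - a / b * db) / b = (b ^+ 2)^-1 * (b * da - a * db).
Proof. by move=> b0; field. Qed.

End QuotientRule.

(** * The bracket over a field of fractions of a polynomial ring *)

Section FractionBracket.
Variables (k : fieldType) (n : nat) (F : fieldType).
Local Notation A := {mpoly k[n]}.
Variables (tf : {rmorphism A -> F}) (fp : 'I_n -> F -> F).
Hypotheses (tf_inj : forall a, tf a = 0 -> a = 0)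
  (tf_frac : forall x, exists p q, tf q != 0 /\ x = tf p / tf q)
  (fp_quot : forall i p q, tf q != 0 -> fp i (tf p / tf q) =
    (tf p^`M(i) - tf p / tf q * tf q^`M(i)) / tf q).

Lemma fp_tf i p : fp i (tf p) = tf p^`M(i).
Proof.
have := @fp_quot i p 1; rewrite rmorph1 !divr1 => -> //; last exact: oner_neq0.
by rewrite -mpolyC1 mderivC rmorph0 mulr0 subr0.
Qed.

Lemma fpD i x y : fp i (x + y) = fp i x + fp i y.
Proof.
have [a [b [b0 ->]]] := tf_frac x; have [c [d [d0 ->]]] := tf_frac y.
rewrite addf_div // -!rmorphM -rmorphD !fp_quot ?rmorphM ?mulf_neq0 //.
by rewrite mderivD !mderivM !(rmorphD, rmorphM) quot_rule_add.
Qed.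

Lemma fpM i x y : fp i (x * y) = x * fp i y + fp i x * y.
Proof.
have [a [b [b0 ->]]] := tf_frac x; have [c [d [d0 ->]]] := tf_frac y.
rewrite mulf_div // -!rmorphM !fp_quot ?rmorphM ?mulf_neq0 //.
by rewrite !mderivM !(rmorphD, rmorphM) quot_rule_mul.
Qed.

Variables (s t : 'I_(n - 2) -> A).
Hypotheses (n_gt1 : (1 < n)%N) (t_neq0 : forall j, t j != 0).

Definition frac_bracket f g : F := (\prod_j tf (t j)) ^+ 2 *
  \det (bracket_mx (fp^~ f) (fp^~ g) (fun j l => fp l (tf (s j) / tf (t j)))).

(** The partial derivative of [s j / t j], multiplied by [t j ^+ 2]. *)
Definition wronskian j l : A := t j * (s j)^`M(l) - s j * (t j)^`M(l).

(** The bracket of the variables [l] and [l'], as a polynomial. *)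
Definition bracket_coef l l' : A :=
  \det (bracket_mx (fun i => (l == i)%:R) (fun i => (l' == i)%:R) wronskian).

(** The prefactor of the bracket clears exactly the denominators [t j ^+ 2] of the last rows, and
    the determinant is bilinear in the first two. *)
Lemma frac_bracketE f g : frac_bracket f g =
  \sum_l \sum_l' fp l f * fp l' g * tf (bracket_coef l l').
Proof.
have tF0 j : tf (t j) != 0 by apply: contra_neq (t_neq0 j) => /tf_inj.
rewrite /frac_bracket.
rewrite (_ : (fun j l => _) = fun j l => (tf (t j) ^+ 2)^-1 * tf (wronskian j l)).
  rewrite (det_bracket_scale n_gt1) mulrA -prodrXl prodfV mulfV ?mul1r;
    last by apply/prodf_neq0 => j _; rewrite expf_neq0.
  rewrite (det_bracket2 n_gt1); do 2 (apply: eq_bigr => ? _); congr (_ * _).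
  rewrite det_bracket_morph; congr (\det _).
  by apply/matrixP => i l; rewrite !mxE /= !rmorph_nat.
apply/funext => j; apply/funext => l; rewrite fp_quot // /wronskian.
by rewrite rmorphB !rmorphM quot_rule_sqr.
Qed.

Lemma frac_bracketD f f' g :
  frac_bracket (f + f') g = frac_bracket f g + frac_bracket f' g.
Proof.
rewrite !frac_bracketE -big_split; apply: eq_bigr => l _; rewrite -big_split.
by apply: eq_bigr => l' _; rewrite fpD /= -!mulrDl.
Qed.

Lemma frac_bracketM f f' g :
  frac_bracket (f * f') g = f * frac_bracket f' g + frac_bracket f g * f'.
Proof.
rewrite !frac_bracketE mulr_sumr mulr_suml -big_split; apply: eq_bigr => l _.
rewrite mulr_sumr mulr_suml -big_split.
by apply: eq_bigr => l' _; rewrite fpM /=; ring.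
Qed.

Lemma frac_bracket_cst c g : frac_bracket (tf c%:MP) g = 0.
Proof.
rewrite frac_bracketE big1 // => l _; rewrite big1 // => l' _.
by rewrite fp_tf mderivC rmorph0 !mul0r.
Qed.

Lemma frac_bracket_ratio j g : frac_bracket (tf (s j) / tf (t j)) g = 0.
Proof.
rewrite /frac_bracket.
by rewrite (det_bracket_X n_gt1 (fp^~ g) (fun j l => fp l (tf (s j) / tf (t j)))) mulr0.
Qed.

(** Identifies the entries [bracket_coef l i], for varying [l], as the Hamiltonian vector of the
    variable [i]. *)
Lemma frac_bracket_var p i :
  frac_bracket (tf p) (tf 'X_i) = tf (\sum_l p^`M(l) * bracket_coef l i).
Proof.
rewrite frac_bracketE rmorph_sum; apply: eq_bigr => l _; rewrite (bigD1 i) //= big1 => [|l' li].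
  by rewrite !fp_tf addr0 mderiv_var eqxx rmorph1 mulr1 rmorphM.
by rewrite !fp_tf mderiv_var eq_sym (negPf li) rmorph0 mulr0 mul0r.
Qed.

Lemma bracket_coef_same l : bracket_coef l l = 0.
Proof. exact: (det_bracket_same n_gt1). Qed.

Lemma bracket_coefC l l' : bracket_coef l l' = - bracket_coef l' l.
Proof. exact: (det_bracketC n_gt1). Qed.

Lemma bracket_coef_wronskian i j : \sum_l wronskian j l * bracket_coef l i = 0.
Proof. by rewrite -(det_bracket_fst n_gt1) (det_bracket_X n_gt1). Qed.

(** * The localization and its central subalgebra *)

Section Loc.
Variable M : A -> Prop.
Hypotheses (M1 : M 1) (MM : forall a b, M a -> M b -> M (a * b)) (M0 : ~ M 0).
Let R : F -> Prop := loc tf M.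

Lemma loc_sum (I : finType) (f : I -> F) : (forall i, R (f i)) -> R (\sum_i f i).
Proof.
move=> Rf; apply: (big_ind R) => //.
- by rewrite -(rmorph0 tf); apply: loc_theta.
- exact: (locD tf_inj MM M0).
Qed.

Lemma fp_loc i x : R x -> R (fp i x).
Proof.
move=> /[dup] Rx [a [m [Mm xE]]].
have m0 : tf m != 0 by apply: contra_not_neq M0 => /tf_inj <-.
rewrite xE fp_quot // -xE; apply: locM => //; last exact: locV.
apply: (locD tf_inj MM M0); first exact: loc_theta.
by rewrite -mulrN -rmorphN; apply: locM => //; apply: loc_theta.
Qed.

Lemma frac_bracket_loc f g : R f -> R g -> R (frac_bracket f g).
Proof.
move=> Rf Rg; rewrite frac_bracketE; apply: loc_sum => l; apply: loc_sum => l'.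
apply: locM => //; last exact: loc_theta.
by apply: locM => //; apply: fp_loc.
Qed.

Hypothesis char0 : forall m, m.+1%:R != 0 :> k.
Variable dlt : 'I_(n - 2) -> bool.
Let num j := if dlt j then s j else t j.
Let den j := if dlt j then t j else s j.
Hypothesis M_den : forall j, M (den j).
Let ratio_morph : {rmorphism {mpoly k[n - 2]} -> F} :=
  mmap (tf \o @mpolyC n k)%FUN (fun j => tf (s j) / tf (t j)).
Hypothesis ratio_indep : forall p : {mpoly k[n - 2]}, ratio_morph p = 0 -> p = 0.

(** The quotients [num j / den j] are the [v_j], so the image is [C_gamma]; [num] and [den] are
    oriented so that the denominators lie in [M]. *)
Definition central_morph : {rmorphism {mpoly k[n - 2]} -> F} :=
  mmap (tf \o @mpolyC n k)%FUN (fun j => tf (num j) / tf (den j)).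

Let centralC c : central_morph c%:MP = tf c%:MP.
Proof. by rewrite /= mmapC. Qed.

Let centralX j : central_morph 'X_j = tf (num j) / tf (den j).
Proof. by rewrite /= mmapX mmap1U. Qed.

Let M_neq0 a : M a -> tf a != 0.
Proof. by move=> Ma; apply: contra_not_neq M0 => /tf_inj <-. Qed.

Let t_n0 j : tf (t j) != 0.
Proof. by apply: contra_neq (t_neq0 j) => /tf_inj. Qed.

Let s_n0 j : tf (s j) != 0.
Proof.
apply/eqP => sj0; have /ratio_indep/(congr1 (mderiv j)) : ratio_morph 'X_j = 0.
  by rewrite /= mmapX mmap1U sj0 mul0r.
by rewrite mderiv_var eqxx linear0 => /eqP; rewrite oner_eq0.
Qed.

(* The ratios [s j / t j] are independent and are rational functions of the
   [num j / den j], so the tangent space of the latter has full dimension. *)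
Lemma central_morph_inj (p : {mpoly k[n - 2]}) : central_morph p = 0 -> p = 0.
Proof.
have [d [U [chU freeU tU]]] := height_tangent char0 central_morph.
pose num' j : {mpoly k[n - 2]} := if dlt j then 'X_j else 1.
pose den' j : {mpoly k[n - 2]} := if dlt j then 1 else 'X_j.
have ratioC c : ratio_morph c%:MP = central_morph c%:MP by rewrite centralC /= mmapC.
have den'0 j : central_morph (den' j) != 0.
  rewrite /den'; have cX := centralX j; rewrite /num /den in cX.
  case: (dlt j) cX => cX; first by rewrite rmorph1 oner_neq0.
  by rewrite cX mulf_neq0 ?invr_neq0.
have ratioX j : ratio_morph 'X_j * central_morph (den' j) = central_morph (num' j).
  have rX : ratio_morph 'X_j = tf (s j) / tf (t j) by rewrite /= mmapX mmap1U.
  rewrite rX /num' /den'; have cX := centralX j; rewrite /num /den in cX.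
  case: (dlt j) cX => cX; rewrite cX rmorph1 ?mulr1 //.
  by rewrite mulf_div [tf (t j) * _]mulrC divff ?mulf_neq0.
have full_row u : tangent ratio_morph u <-> (u <= (1%:M : 'M[F]_(n - 2)))%MS.
  split=> _; first exact: submx1.
  move=> f /ratio_indep ->; rewrite /tan_along big1 // => l _.
  by rewrite linear0 rmorph0 mulr0.
have freeI : row_free (1%:M : 'M[F]_(n - 2)) by rewrite /row_free mxrank1.
(* This gives [d >= n - 2], whereas a nonzero [p] in the kernel would give a prime of height at
   least 1, hence [1 + d <= n - 2]. *)
have dE := tangent_fibration char0 ratioC ratioX den'0 freeU tU freeI full_row.
move=> p0; apply: contrapT => pn0.
have /chU : ht_chain 1 (fun a : {mpoly k[n - 2]} => central_morph a = 0).
  split; first exact: (kernel_prime (psi := central_morph)).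
  exists (fun a : {mpoly k[n - 2]} => a = 0); split; last by exists p.
    by split=> //; apply: (kernel_prime (psi := idfun)).
  by move=> a ->; rewrite rmorph0.
by rewrite dE add1n ltnNge leq_addr.
Qed.

Lemma frac_bracket_central (p : {mpoly k[n - 2]}) g : frac_bracket (central_morph p) g = 0.
Proof.
elim/mpoly_ringind: p => [c|j|p q Ep Eq|p q Ep Eq].
- by rewrite centralC frac_bracket_cst.
- rewrite centralX /num /den; case: (dlt j); first exact: frac_bracket_ratio.
  (* For an inverted ratio, the Leibniz rule is applied to its product with the ratio, which is the
     constant 1. *)
  have := frac_bracketM (tf (s j) / tf (t j)) (tf (t j) / tf (s j)) g.
  rewrite frac_bracket_ratio mul0r addr0 mulf_div [tf (t j) * _]mulrC divff ?mulf_neq0 //.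
  rewrite -[1](rmorph1 tf) -mpolyC1 frac_bracket_cst => /esym/eqP.
  have r0 : tf (s j) / tf (t j) != 0 by rewrite mulf_neq0 ?invr_neq0.
  by rewrite mulf_eq0 (negPf r0) => /eqP.
- by rewrite rmorphD frac_bracketD Ep Eq addr0.
- by rewrite rmorphM frac_bracketM Ep Eq mulr0 mul0r addr0.
Qed.

Section Point.
Variable K : fieldType.
Variables (psi : {rmorphism A -> K}) (chi : {rmorphism {mpoly k[n - 2]} -> K}).
Hypotheses (chiX : forall j, chi 'X_j * psi (den j) = psi (num j))
  (den_neq0 : forall j, psi (den j) != 0).
Variables i0 j0 : 'I_n.
Hypothesis coef_neq0 : psi (bracket_coef i0 j0) != 0.
Let J := quot_jacobian psi chi num den.

(** Column [j] of [J] times [psi (den j) ^+ 2] is the Wronskian column, up to a sign that records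
    whether the ratio is inverted. *)
Let jacobian_wronskian (u : 'rV[K]_n) :
  u *m J = 0 <-> forall j, \sum_l u 0 l * psi (wronskian j l) = 0.
Proof.
have wE j : \sum_l u 0 l * psi (wronskian j l) =
    psi (t j) * tan_along psi u (s j) - psi (s j) * tan_along psi u (t j).
  rewrite !mulr_sumr -sumrB; apply: eq_bigr => l _.
  by rewrite rmorphB !rmorphM; ring.
have E j : (u *m J) 0 j * psi (den j) ^+ 2 =
    (if dlt j then 1 else -1) * \sum_l u 0 l * psi (wronskian j l).
  rewrite quot_jacobianE wE expr2 mulrA divfK ?den_neq0 // mulrBl mulrAC chiX.
  by rewrite /num /den; case: (dlt j); ring.
split=> [uJ0 j|w0]; last first.
  apply/rowP => j; rewrite [RHS]mxE; apply/eqP.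
  have /eqP := E j; rewrite w0 mulr0 mulf_eq0 expf_eq0 /= (negPf (den_neq0 j)).
  by rewrite orbF.
have /esym/eqP := E j; rewrite uJ0 mxE mul0r mulf_eq0 => /orP[|/eqP //].
by case: ifP; rewrite ?oppr_eq0 oner_eq0.
Qed.

(** [E] extracts the coordinates [i0] and [j0]. A kernel vector on which both vanish is annihilated
    by the matrix [B], whose determinant is the nonzero [psi (bracket_coef i0 j0)]. *)
Lemma rank_ker_jacobian_le d (U : 'M[K]_(d, n)) :
  (\rank (U :&: kermx J)%MS <= 2)%N.
Proof.
set V := (U :&: _)%MS.
pose E : 'M[K]_(n, 2) := \matrix_(l, c) (l == if c == 0 then i0 else j0)%:R.
rewrite -(mxrank_mul_ker V E) [X in (_ + X)%N](_ : _ = 0%N) ?addn0 ?rank_leq_col //.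
apply/eqP; rewrite mxrank_eq0 -submx0; apply/rV_subP => u.
rewrite !sub_capmx => /andP[/andP[_ /sub_kermxP uJ] /sub_kermxP uE].
have uE' (c : 'I_2) : u 0 (if c == 0 then i0 else j0) = 0.
  have /rowP/(_ c) := uE; rewrite !mxE (bigD1 (if c == 0 then i0 else j0)) //=.
  rewrite mxE eqxx mulr1 big1 ?addr0 // => l /negPf lc.
  by rewrite mxE lc mulr0.
pose B := map_mx psi (bracket_mx (fun i => (i0 == i)%:R) (fun i => (j0 == i)%:R) wronskian).
have B_unit : B \in unitmx by rewrite unitmxE det_map_mx unitfE.
have Bu : B *m u^T = 0.
  have sum_delta i : u 0 i = 0 -> \sum_l psi (i == l)%:R * u^T l 0 = 0.
    move=> ui0; rewrite big1 // => l _; rewrite mxE.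
    by have [<-|_] := eqVneq i l; rewrite ?ui0 ?mulr0 // rmorph0 mul0r.
  apply/colP => i; rewrite [RHS]mxE mxE.
  case: (bracket_ordP n_gt1 i) => [||j].
  - rewrite -[RHS](sum_delta i0) ?(uE' 0) //; apply: eq_bigr => l _; by rewrite 2!mxE.
  - rewrite -[RHS](sum_delta j0) ?(uE' 1) //; apply: eq_bigr => l _; by rewrite 2!mxE.
  rewrite -[RHS]((jacobian_wronskian u).1 uJ j); apply: eq_bigr => l _.
  by rewrite mxE bracket_mx_shift mxE mulrC.
by rewrite -[u]trmxK -(mulKmx B_unit u^T) Bu mulmx0 trmx0 sub0mx.
Qed.

(** The Hamiltonian vectors of the variables [i0] and [j0] lie in the kernel. They are independent:
    their coordinates at [i0] and [j0] form an antisymmetric matrix with nonzero off-diagonal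
    entry. *)
Lemma rank_ker_jacobian_eq d (U : 'M[K]_(d, n)) :
  (forall i, tangent psi (\row_l psi (bracket_coef l i))) ->
  (forall u, tangent psi u -> (u <= U)%MS) -> \rank (U :&: kermx J)%MS = 2%N.
Proof.
move=> tH tU; apply/eqP; rewrite eqn_leq rank_ker_jacobian_le /=.
pose ij (c : 'I_2) := if c == 0 then i0 else j0.
pose H : 'M[K]_(2, n) := \matrix_(c, l) psi (bracket_coef l (ij c)).
have rkH : \rank H = 2%N.
  apply/eqP; rewrite -[_ == _]/(row_free H); apply: inj_row_free => v vH0.
  have vH l : v 0 0 * psi (bracket_coef l i0) + v 0 1 * psi (bracket_coef l j0) = 0.
    have /rowP/(_ l) := vH0; rewrite !mxE big_ord_recl big_ord1 !mxE /ij.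
    by rewrite (_ : lift ord0 ord0 = 1) //; apply/val_inj.
  have v1 : v 0 1 = 0.
    have /eqP := vH i0; rewrite bracket_coef_same rmorph0 mulr0 add0r mulf_eq0.
    by rewrite (negPf coef_neq0) orbF => /eqP.
  have v0 : v 0 0 = 0.
    have /eqP := vH j0; rewrite v1 mul0r addr0 bracket_coefC rmorphN mulrN oppr_eq0.
    by rewrite mulf_eq0 (negPf coef_neq0) orbF => /eqP.
  apply/rowP => c; rewrite mxE; case: (unliftP 0 c) => [c' ->|-> //].
  by rewrite (ord1 c') -[RHS]v1; congr (v 0 _); apply/val_inj.
rewrite -[X in (X <= _)%N]rkH; apply: mxrankS; apply/row_subP => c; rewrite sub_capmx.
have rowH : row c H = \row_l psi (bracket_coef l (ij c)) by apply/rowP => l; rewrite !mxE.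
rewrite rowH tU //=; apply/sub_kermxP/jacobian_wronskian => j.
rewrite -[RHS](rmorph0 psi) -(bracket_coef_wronskian (ij c) j) rmorph_sum.
by apply: eq_bigr => l _; rewrite mxE rmorphM mulrC.
Qed.

End Point.

Let one_elt (a : {mpoly k[n - 2]}) := a = 1.
Let C : F -> Prop := fun x => exists p, x = central_morph p.

Let CE : C = loc central_morph one_elt.
Proof.
apply: pred_ext => x; split=> [[a ->]|[a [_ [-> ->]]]]; exists a.
  by exists 1; rewrite rmorph1 divr1.
by rewrite rmorph1 divr1.
Qed.

Let R_theta a : R (tf a).
Proof. exact: loc_theta. Qed.

Let central_loc p : R (central_morph p).
Proof.
elim/mpoly_ringind: p => [c|j|p q Rp Rq|p q Rp Rq].
- by rewrite centralC.
- by rewrite centralX; exists (num j), (den j).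
- by rewrite rmorphD; apply: (locD tf_inj MM M0).
- by rewrite rmorphM; apply: locM.
Qed.

Let poisson_closed (Q : F -> Prop) := forall a b, Q a -> R b -> Q (frac_bracket a b).

(** [d] and [d'] are the dimensions of the tangent spaces at the points given by [Q] and by its
    contraction to [C]; they differ by the dimension of the kernel of the Jacobian. *)
Lemma prime_dims (Q : F -> Prop) : is_prime R Q ->
  (exists i j, ~ Q (tf (bracket_coef i j))) ->
  exists d d', [/\ forall m, ht_chain m (fun a => Q (tf a)) <-> (m + d <= n)%N,
    forall m, ht_chain m (fun p => Q (central_morph p)) <-> (m + d' <= n - 2)%N,
    (d <= d' + 2)%N & poisson_closed Q -> d = (d' + 2)%N].
Proof.
move=> Qp [i0 [j0 Qij]].
have [K [psi kerpsi]] := prime_kernel (prime_contract M1 Qp).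
have psi_M a : M a -> psi a != 0.
  by move=> Ma; apply/eqP => /kerpsi; apply: (prime_denom tf_inj M1 M0 Qp).
pose chi : {rmorphism {mpoly k[n - 2]} -> K} :=
  mmap (psi \o @mpolyC n k)%FUN (fun j => psi (num j) / psi (den j)).
have chiC c : chi c%:MP = psi c%:MP by rewrite /= mmapC.
have den0 j : psi (den j) != 0 by apply: psi_M.
have chiX j : chi 'X_j * psi (den j) = psi (num j).
  by rewrite /= mmapX mmap1U divfK.
have kerchi p : chi p = 0 <-> Q (central_morph p).
  have [a [e [Me cE chiE]]] : exists a e, [/\ M e,
      central_morph p = tf a / tf e & chi p * psi e = psi a].
    elim/mpoly_ringind: p => [c|j|p q [a [e [Me pE cpE]]] [b [f [Mf qE cqE]]]
        |p q [a [e [Me pE cpE]]] [b [f [Mf qE cqE]]]].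
    - by exists c%:MP, 1; rewrite centralC chiC !rmorph1 divr1 mulr1.
    - by exists (num j), (den j); rewrite centralX chiX.
    - exists (a * f + b * e), (e * f); split; first exact: MM.
        by rewrite (rmorphD central_morph) pE qE addf_div ?M_neq0 // rmorphD !rmorphM.
      by rewrite !rmorphD !rmorphM -cpE -cqE; ring.
    - exists (a * b), (e * f); split; first exact: MM.
        by rewrite (rmorphM central_morph) pE qE mulf_div !rmorphM.
      by rewrite !rmorphM -cpE -cqE; ring.
  rewrite cE; split=> [chi0|/(prime_numer tf_inj M1 M0 Qp a Me)/kerpsi psi0].
    by apply/(prime_numer tf_inj M1 M0 Qp a Me)/kerpsi; rewrite -chiE chi0 mul0r.
  by move/eqP: chiE; rewrite psi0 mulf_eq0 (negPf (psi_M _ Me)) orbF => /eqP.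
have coef0 : psi (bracket_coef i0 j0) != 0 by apply/eqP => /kerpsi.
have [d [U [chU freeU tU]]] := height_tangent char0 psi.
have [d' [U' [chU' freeU' tU']]] := height_tangent char0 chi.
exists d, d'; rewrite -(pred_ext kerpsi) -(pred_ext kerchi); split=> //.
  rewrite (tangent_fibration char0 chiC chiX den0 freeU tU freeU' tU').
  by rewrite leq_add2l (rank_ker_jacobian_le chiX den0 coef0).
move=> Qbr; rewrite [LHS](tangent_fibration char0 chiC chiX den0 freeU tU freeU' tU').
congr (_ + _)%N; apply: (rank_ker_jacobian_eq chiX den0 coef0) => [i|u /tU //].
(* For [f] in [Q], its bracket with a variable is again in [Q]; read through [psi], this says that
   the Hamiltonian vector is tangent. *)
move=> f /kerpsi Qf; have := Qbr _ _ Qf (R_theta 'X_i).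
rewrite frac_bracket_var => /kerpsi; rewrite rmorph_sum => sum0.
rewrite -[RHS]sum0; apply: eq_bigr => l _.
by rewrite mxE rmorphM mulrC.
Qed.

Lemma central_contract_prime (Q : F -> Prop) : is_prime R Q ->
  is_prime C (fun x => Q x /\ C x).
Proof.
have CR x : C x -> R x by case=> p ->.
move=> [[QR [Q0 [QD QM]]] [Q1 Qpr]]; split; [split; [|split; [|split]]|split].
- by move=> x [].
- by split=> //; exists 0; rewrite rmorph0.
- move=> x y [Qx [p xE]] [Qy [q yE]]; split; first exact: QD.
  by exists (p + q); rewrite rmorphD xE yE.
- move=> x y [p xE] [Qy [q yE]]; split; first by apply: QM => //; apply: CR; exists p.
  by exists (p * q); rewrite rmorphM xE yE.
- by case.
- move=> x y Cx Cy [Qxy _].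
  by case: (Qpr x y (CR _ Cx) (CR _ Cy) Qxy) => ?; [left | right].
Qed.

(** The derivation [frac_bracket^~ b] kills [C], hence preserves the ideal generated by [I], and
    [minimal_prime_invariant] applies. *)
Lemma central_ext_prime_poisson (I Q : F -> Prop) : is_ideal C I ->
  minimal_prime_over R (ext_ideal R I) Q -> is_prime R Q /\ poisson_closed Q.
Proof.
move=> [IC _] Qmin; split; first by case: Qmin.
have nat_inv m : m.+1%:R^-1 = tf (m.+1%:R^-1)%:MP.
  by rewrite -[RHS]/((tf \o @mpolyC n k)%FUN _) fmorphV rmorph_nat.
move=> a b Qa Rb; move: a Qa.
apply: (@minimal_prime_invariant F R (frac_bracket^~ b) _ _ _ _ _ _ _ _ _ (ext_ideal R I) Q _ Qmin).
- by move=> x y; apply: frac_bracketD.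
- by move=> x y; apply: frac_bracketM.
- by move=> x Rx; apply: frac_bracket_loc.
- by rewrite -(rmorph0 tf).
- by rewrite -(rmorph1 tf) -rmorphN.
- by move=> m; rewrite nat_inv.
- exact: (rmorph_char0 char0 tf).
- exact: (locD tf_inj MM M0).
- exact: locM.
move=> x extx J Jid IJ.
have [JR [J0 [JD JM]]] := Jid.
(* The extension lies in every ideal containing [I], in particular in the ideal of those [y] in [J]
   whose bracket with [b] is also in [J]. *)
suff /(extx (fun y => J y /\ J (frac_bracket y b)))[] :
    is_ideal R (fun y => J y /\ J (frac_bracket y b)).
  - by move=> y Iy; split; [exact: IJ | have [p ->] := IC y Iy; rewrite frac_bracket_central].
  - by [].
split; [|split; [|split]].
- by move=> y [/JR].
- by split=> //; rewrite -(rmorph0 central_morph) frac_bracket_central.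
- by move=> y z [Jy Jby] [Jz Jbz]; rewrite frac_bracketD; split; apply: JD.
- move=> r y Rr [Jy Jby]; rewrite frac_bracketM; split; first exact: JM.
  by apply: JD; [exact: JM | apply: JM => //; apply: frac_bracket_loc].
Qed.

Lemma proper_poisson_heights (Q : F -> Prop) : is_prime R Q -> poisson_closed Q ->
  (exists a b, R a /\ R b /\ ~ Q (frac_bracket a b)) ->
  same_height R Q C (fun x => Q x /\ C x) /\
  minimal_prime_over R (ext_ideal R (fun x => Q x /\ C x)) Q.
Proof.
move=> Qp Qbr [a [b [Ra [Rb Qab]]]].
have [[QR [Q0 [QD QM]]] [Q1 Qpr]] := Qp.
have Qij : exists i j, ~ Q (tf (bracket_coef i j)).
  apply: contrapT => Qij; apply: Qab; rewrite frac_bracketE.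
  apply: (big_ind Q) => // l _; apply: (big_ind Q) => // l' _.
  apply: QM; first by apply: locM => //; apply: fp_loc.
  by apply: contrapT => Qll'; apply: Qij; exists l, l'.
have [d [d' [chd chd' _ dE]]] := prime_dims Qp Qij.
have {}dE := dE Qbr.
have d_le Q2 : is_prime R Q2 -> forall e, (forall m,
    ht_chain m (fun x => Q2 (tf x)) <-> (m + e <= n)%N) -> (e <= n)%N.
  by move=> Q2p e he; apply: (he 0%N).1; split=> //; apply: (prime_contract M1 Q2p).
split.
  move=> m; have one_prod (x y : {mpoly k[n - 2]}) : one_elt x -> one_elt y -> one_elt (x * y).
    by move=> -> ->; apply: mulr1.
  have one_n0 : ~ one_elt 0 by move/esym/eqP; rewrite oner_eq0.
  have Cp := central_contract_prime Qp; move: Cp; rewrite CE => Cp.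
  rewrite (ht_ge_chain tf_inj M1 MM M0 m Qp) chd dE.
  rewrite (ht_ge_chain central_morph_inj erefl one_prod one_n0 m Cp) -CE.
  rewrite (_ : (fun x => _ /\ _) = fun p => Q (central_morph p)); last first.
    by apply: pred_ext => p; split=> [[]|Qx] //; split=> //; exists p.
  by rewrite chd' addnA leq_subRL // [(2 + _)%N]addnC.
split=> //; split=> [x extx|Q2 Q2p extQ2 Q2Q x Qx].
  by apply: extx => [|y []] //; case: Qp.
apply: contrapT => nQ2x.
have [y [Qy nQ2y]] : exists y, Q (tf y) /\ ~ Q2 (tf y).
  have [y [m [Mm xE]]] := QR x Qx; exists y; split.
    by apply/(prime_numer tf_inj M1 M0 Qp y Mm); rewrite -xE.
  by move/(prime_numer tf_inj M1 M0 Q2p y Mm); rewrite -xE.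
have Q2ij : exists i j, ~ Q2 (tf (bracket_coef i j)).
  by have [i [j Qij']] := Qij; exists i, j => /Q2Q.
have [e [e' [che che' e_le _]]] := prime_dims Q2p Q2ij.
(* [Q2] contains the contraction of [Q] and is contained in [Q], so both have the same contraction
   to [C]. *)
have e'E : (e' <= d')%N.
  have Qc : (fun p => Q (central_morph p)) = (fun p => Q2 (central_morph p)).
    apply: pred_ext => p; split=> [Qcp|/Q2Q //].
    by apply: extQ2 => J _; apply; split=> //; exists p.
  have d'_le : (d' <= n - 2)%N.
    rewrite -(leq_add2r 2) -dE (leq_trans (d_le _ Qp _ chd)) //.
    by rewrite subnK.
  have : ht_chain (n - 2 - d') (fun p => Q (central_morph p)) by apply/chd'; rewrite subnK.
  by rewrite Qc => /che'; rewrite -{2}(subnK d'_le) leq_add2l.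
have e_n := d_le _ Q2p _ che.
(* [Q2] has height [n - e] and lies strictly below [Q], so [d < e]; yet
   [e <= e' + 2 <= d' + 2 = d]. *)
have /chd : ht_chain (n - e).+1 (fun x => Q (tf x)).
  split; first exact: (prime_contract M1 Qp).
  exists (fun x => Q2 (tf x)); split; [|by move=> z /Q2Q|by exists y].
  by apply/che; rewrite subnK.
rewrite addSn -{2}(subnK e_n) -addnS leq_add2l => lt_de.
have := leq_trans lt_de (leq_trans e_le (leq_add e'E (leqnn 2))).
by rewrite dE ltnn.
Qed.

End Loc.
End FractionBracket.

(** * Specialization to the complex numbers *)

Lemma CC_char0 m : m.+1%:R != 0 :> CC.
Proof. by rewrite Num.Theory.pnatr_eq0. Qed.

Section FractionField.
Variable n : nat.

Lemma tofrac_eq0_imp (a : Apoly n) : a%:F = 0 -> a = 0.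
Proof. by move=> /eqP; rewrite tofrac_eq0 => /eqP. Qed.

Lemma frac_numden (x : Frac n) : (fden x)%:F != 0 /\ x = (fnum x)%:F / (fden x)%:F.
Proof.
have d0 : (fden x)%:F != 0 by rewrite tofrac_eq0; apply: denom_ratioP.
split=> //; apply: (canRL (mulfK _)) => //.
rewrite -[X in X * _]reprK /fnum /fden /=; unlock FracField.tofrac.
rewrite -[LHS](FracField.pi_mul); apply/eqmodP.
rewrite /= FracField.equivfE /FracField.mulf /=.
rewrite !numden_Ratio ?(oner_neq0, mulf_neq0, denom_ratioP) //.
by rewrite !mulr1 mulrC.
Qed.

(** [fpartial] uses the representative chosen by [repr]; differentiating the cross-multiplied
    identity [p * b = a * q] transfers the quotient rule to any other one. *)
Lemma fpartial_quot i (p q : Apoly n) : q%:F != 0 ->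
  fpartial i (p%:F / q%:F) = ((p^`M(i))%:F - p%:F / q%:F * (q^`M(i))%:F) / q%:F.
Proof.
move=> q0; have [] := frac_numden (p%:F / q%:F).
rewrite /fpartial; set a := fnum _; set b := fden _ => b0 E.
apply: (quot_rule_rep q0 b0 E).
have pb : p * b = a * q.
  by move/eqP: E; rewrite (eqr_div _ _ q0 b0) -!tofracM tofrac_eq => /eqP.
have dpb : p^`M(i) * b + p * b^`M(i) = a^`M(i) * q + a * q^`M(i).
  by rewrite -(mderivM i p b) -(mderivM i a q) pb.
by rewrite -!tofracM -!tofracD dpb.
Qed.

Lemma pbracket_frac (s t : 'I_(n - 2) -> Apoly n) :
  pbracket s t = frac_bracket (@FracField.tofrac (Apoly n)) (@fpartial n) s t.
Proof.
apply/funext => f; apply/funext => g; congr (_ * \det _).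
apply/matrixP => i l; rewrite !mxE /jac_args.
case: ifP => // _; case: ifP => // _; case: insub => //=.
(* The default argument [0] of [jac_args] has zero partial derivatives, in agreement with the
   default row of [bracket_mx]. *)
have := @fpartial_quot l 0 1; rewrite tofrac0 tofrac1 mul0r => ->; last exact: oner_neq0.
by rewrite linear0 tofrac0 mul0r subr0 mul0r.
Qed.

End FractionField.

Unset Implicit Arguments.
Set Strict Implicit.

Theorem theorem2p19 (n : nat) (s t : 'I_(n - 2) -> Apoly n)
  (gam dlt : 'I_(n - 2) -> bool) :
  (3 <= n)%N ->
  (forall j, t j != 0) ->
  (forall j, coprime_poly (s j) (t j)) ->
  alg_indep s t ->
  dense gam dlt ->
  (* (1) *)
  (forall I : Frac n -> Prop, is_ideal (Cgamma s t dlt) I ->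
     forall Q : Frac n -> Prop,
       minimal_prime_over (Agamma s t gam dlt)
         (ext_ideal (Agamma s t gam dlt) I) Q ->
       poisson_prime s t gam dlt Q)
  /\
  (* (2) and (3) *)
  (forall Q : Frac n -> Prop,
     poisson_prime s t gam dlt Q -> nonzero_ideal Q ->
     proper_poisson s t gam dlt Q ->
     same_height (Agamma s t gam dlt) Q
       (Cgamma s t dlt) (fun x => Q x /\ Cgamma s t dlt x)
     /\
     minimal_prime_over (Agamma s t gam dlt)
       (ext_ideal (Agamma s t gam dlt) (fun x => Q x /\ Cgamma s t dlt x)) Q).
Proof.
move=> n3 t0 _ indep_st dense_gd; have n2 := ltnW n3.
have s0 j : s j != 0.
  apply/negP => /eqP sj0; have /indep_st/(congr1 (mderiv j)) : mmap (@cst n) (sratio s t) 'X_j = 0.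
    rewrite (mmapX _ (@FracField.tofrac (Apoly n) \o @mpolyC n CC)%FUN) mmap1U.
    by rewrite /sratio sj0 tofrac0 mul0r.
  by rewrite mderiv_var eqxx linear0 => /eqP; rewrite oner_eq0.
have M1 : Mgamma s t gam dlt 1.
  by exists (fun=> 0%N), (fun=> 0%N); rewrite big1 // => j _; rewrite !expr0 !if_same mulr1.
have MM a b : Mgamma s t gam dlt a -> Mgamma s t gam dlt b -> Mgamma s t gam dlt (a * b).
  move=> [e [f ->]] [e' [f' ->]]; exists (fun j => e j + e' j)%N, (fun j => f j + f' j)%N.
  rewrite -big_split; apply: eq_bigr => j _ /=; rewrite mulrACA !exprD.
  by congr (_ * _); case: ifP; rewrite ?mulr1.
have M0 : ~ Mgamma s t gam dlt 0.
  move=> [e [f /esym/eqP]]; apply/negP/prodf_neq0 => j _.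
  by rewrite mulf_neq0 //; case: ifP; rewrite ?expf_neq0 ?oner_neq0.
have M_den j : Mgamma s t gam dlt (if dlt j then t j else s j).
  (* A single exponent 1 at [j], on [t j] or on [s j] according to [dlt j]; in the second case
     density gives [gam j]. *)
  exists (fun i => (i == j) && ~~ dlt j : nat), (fun i => (i == j) && dlt j : nat).
  rewrite (bigD1 j) //= big1 ?mulr1 => [|i /negPf ->]; last first.
    by rewrite !expr0 !if_same mulr1.
  rewrite eqxx; have := dense_gd j; case: (dlt j) => /= [_|].
    by rewrite expr0 if_same mul1r expr1.
  by rewrite orbF => ->; rewrite expr1 mulr1.
have tf_frac (x : Frac n) : exists p q : Apoly n, q%:F != 0 /\ x = p%:F / q%:F.
  by exists (fnum x), (fden x); apply: frac_numden.
have CE : Cgamma s t dlt = fun x => exists p, x =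
    central_morph (@FracField.tofrac (Apoly n)) s t dlt p.
  have vE : vgamma s t dlt = fun j =>
      (if dlt j then s j else t j)%:F / (if dlt j then t j else s j)%:F.
    by apply/funext => j; rewrite /vgamma; case: (dlt j).
  by apply/funext => x; rewrite /Cgamma vE.
have part1 := central_ext_prime_poisson (@tofrac_eq0_imp n) tf_frac (@fpartial_quot n)
  n2 t0 M1 MM M0 CC_char0 indep_st.
have part23 := proper_poisson_heights (@tofrac_eq0_imp n) (@fpartial_quot n)
  n2 t0 M1 MM M0 CC_char0 M_den indep_st.
rewrite /poisson_prime /proper_poisson pbracket_frac CE; split=> [I II Q Qmin|Q [Qp Qbr] _ Qprop].
  exact: part1 II Qmin.
exact: part23 Qp Qbr Qprop.
Qed.
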